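(* Let $(a_{ij})_{1\le i\le p,\ 1\le j\le q}$ be a rational matrix such that the homogeneous system of linear equations $$\sum_{j=1}^q a_{ij} x_j = 0, \qquad i = 1,2,\ldots,p,$$ is partition-regular. Then for every WM set $A \subset \mathbb{N}$ the system has a solution $(x_1,\ldots,x_q) \in A^q$.
   Context: A system of linear equations in $q$ unknowns is partition-regular if for every finite partition $\mathbb{N} = C_1 \cup \cdots \cup C_r$ there is some $C_j$ such that the system has a solution in $C_j^q$. $\mathbb{N}$ denotes the positive integers and $\mathbb{N}_0 = \mathbb{N} \cup \{0\}$. Let $\Omega = \{0,1\}^{\mathbb{N}_0}$ with the product topology and the continuous shift $T:\Omega \to \Omega$, $(T\omega)_n = \omega_{n+1}$. For $\xi \in \Omega$ let $X_\xi = \overline{\{T^n \xi : n \in \mathbb{N}_0\}} \subset \Omega$. A measure preserving system $(X,\mathbb{B},\mu,T)$ consists of a compact metric space $X$, its Borel $\sigma$-algebra $\mathbb{B}$, a continuous map $T: X \to X$ and a $T$-invariant probability measure $\mu$ on $\mathbb{B}$. It is ergodic if every $B \in \mathbb{B}$ with $T^{-1}B = B$ has $\mu(B) \in \{0,1\}$; it is weakly mixing if $(X \times X, \mathbb{B}_{X\times X}, \mu\times\mu, T \times T)$ is ergodic. A point $\xi \in X$ is generic for $(X,\mathbb{B},\mu,T)$ if $\lim_{N\to\infty} \frac1N \sum_{n=0}^{N-1} f(T^n \xi) = \int_X f\, d\mu$ for every continuous $f$ on $X$. The density of $S \subset \mathbb{N}$ is $d(S) = \lim_{N\to\infty} \frac1N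 \sum_{n=1}^N 1_S(n)$, when the limit exists. A set $S \subset \mathbb{N}$ is a WM set if there is a measure $\mu$ such that $1_S \in \{0,1\}^{\mathbb{N}_0}$ is a generic point of the weakly mixing system $(X_{1_S},\mathbb{B},\mu,T)$, and $d(S) > 0$. *)

(* Defs.v *)
From HB Require Import structures.
From mathcomp Require Import all_boot all_order all_algebra.
From mathcomp Require Import all_classical all_reals all_analysis.

Set Implicit Arguments.
Unset Strict Implicit.
Unset Printing Implicit Defensive.

Import Order.TTheory GRing.Theory Num.Theory.
Import numFieldNormedType.Exports.

Local Open Scope classical_set_scope.
Local Open Scope ring_scope.

Definition solution (p q : nat) (a : 'M[rat]_(p, q)) (x : 'I_q -> nat) : Prop :=
  forall i : 'I_p, \sum_(j < q) a i j * (x j)%:R = 0.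

Definition positive_integers : set nat := [set n | (0 < n)%N].

Definition partition_regular (p q : nat) (a : 'M[rat]_(p, q)) : Prop :=
  forall (r : nat) (C : 'I_r -> set nat),
    partition [set: 'I_r] C positive_integers ->
    exists (k : 'I_r) (x : 'I_q -> nat),
      (forall j, C k (x j)) /\ solution a x.

Definition metrizable (R : realType) (X : topologicalType) : Prop :=
  exists d : X -> X -> R,
    [/\ forall x y, d x y = 0 <-> x = y,
        forall x y, d x y = d y x,
        forall x y z, d x z <= d x y + d y z &
        forall x, nbhs x =
          filter_from [set e : R | 0 < e] (fun e => [set y | d x y < e])].

Notation borel X := (g_sigma_algebraType (@open X)).

Record measure_preserving_system (R : realType) (X : ptopologicalType)
    (T : X -> X) (mu : probability (borel X) R) : Prop := {
  mps_compact : compact [set: X] ;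
  mps_metrizable : metrizable R X ;
  mps_continuous : continuous T ;
  mps_invariant : forall B : set (borel X),
    measurable B -> mu (T @^-1` B) = mu B
}.

(* [mu] is only required to be a set function, so that the definition also
   applies to [mu \x mu] on the Borel sets of [X * X]: the library types it as
   a measure on the product sigma-algebra of [borel X] with itself, which is
   the Borel sigma-algebra of [X * X] when [X] is compact metrizable. *)
Definition ergodic (R : realType) (X : topologicalType)
    (T : X -> X) (mu : set X -> \bar R) : Prop :=
  forall B : set X, <<s @open X >> B -> T @^-1` B = B ->
    mu B = 0%E \/ mu B = 1%E.

Definition weakly_mixing (R : realType) (X : ptopologicalType)
    (T : X -> X) (mu : probability (borel X) R) : Prop :=
  @ergodic R (X * X)%type (fun z => (T z.1, T z.2)) (mu \x mu)%E.

Definition generic (R : realType) (X : ptopologicalType)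
    (T : X -> X) (mu : probability (borel X) R) (x : X) : Prop :=
  forall f : X -> R, continuous f ->
    (fun N : nat => N%:R^-1 * \sum_(0 <= n < N) f (iter n T x)) @ \oo
      --> \int[mu]_y f y.

Definition left_shift (w : cantor_space) : cantor_space := fun n => w n.+1.

Lemma left_shift_continuous : continuous left_shift.
Proof.
move=> w; apply/cvg_sup => n; move: w.
apply/(@continuousP _ (initial_topology (@^~ n))) => _ [B oB <-].
have /continuousP cn : continuous (fun w : cantor_space => w n.+1).
  exact: (@proj_continuous nat (fun=> bool) n.+1).
exact: (cn B oB).
Qed.

Definition orbit_closure (xi : cantor_space) : set cantor_space :=
  closure (range (fun n => iter n left_shift xi)).

Lemma mem_orbit_closure (xi : cantor_space) : xi \in orbit_closure xi.
Proof. by apply/mem_set/subset_closure; exists 0%N. Qed.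

Lemma shift_orbit_closure (xi w : cantor_space) :
  w \in orbit_closure xi -> left_shift w \in orbit_closure xi.
Proof.
move=> /set_mem cw; apply/mem_set => B Bw.
have [_ [[n _ <-] Bn]] := cw _ (left_shift_continuous Bw).
by exists (iter n.+1 left_shift xi); split => //; exists n.+1.
Qed.

Definition subshift (xi : cantor_space) : Type := set_type (orbit_closure xi).

HB.instance Definition _ (xi : cantor_space) :=
  Topological.copy (subshift xi) (set_type (orbit_closure xi)).

Definition subshift_point (xi : cantor_space) : subshift xi :=
  SigSub (mem_orbit_closure xi).

HB.instance Definition _ (xi : cantor_space) :=
  isPointed.Build (subshift xi) (subshift_point xi).

Definition subshift_map (xi : cantor_space) (w : subshift xi) : subshift xi :=
  SigSub (shift_orbit_closure (valP w)).

Definition indicator (S : set nat) : cantor_space := fun n => n \in S.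

Definition has_density (R : realType) (S : set nat) (d : R) : Prop :=
  (fun N : nat => N%:R^-1 * \sum_(1 <= n < N.+1) \1_S n : R) @ \oo --> d.

Definition WM_set (R : realType) (S : set nat) : Prop :=
  [/\ S `<=` positive_integers,
      exists mu : probability (borel (subshift (indicator S))) R,
        [/\ measure_preserving_system (@subshift_map (indicator S)) mu,
            weakly_mixing (@subshift_map (indicator S)) mu &
            generic (@subshift_map (indicator S)) mu
              (subshift_point (indicator S))] &
      exists2 d : R, has_density S d & 0 < d].

(* Main.v *)
(** By Rado's argument, colouring the integers by the last nonzero digit in a
    large prime base, partition regularity yields blocks of unknowns and, for
    each block [v], a natural solution vector equal to a constant [c] on [v] and
    to [0] on the later blocks.  A combination [sum_v y_v Z_v] of these vectors
    then has all its entries of the form [c y_i + sum_(j < i) l_j y_j] with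
    bounded [l_j], and it remains to choose the [y_i] so that all such numbers
    lie in [A].

    The [y_i] are chosen one after the other.  If [b] is the indicator of the [n]
    such that [n + sum_(j < i) l_j y_j] lies in [A] for all [l], one needs [n] with
    [b(cn) <> 0] such that [b(m) b(m + n) ... b(m + P n)] has nonzero mean in [m].
    The first factor has nonzero mean along multiples of [c], the second one
    converges in density to a power of the mean of [b] (weak mixing of all
    orders); both follow from van der Corput's inequality applied to sequences
    [n |-> f (T^n xi)] with [f] continuous, whose means are integrals.

    The only input from ergodic theory is that correlations of [f] tend to [0] in
    density, a consequence of the ergodic theorem for [T x T] applied to
    [f (x) f]; that theorem is obtained from Garsia's maximal inequality. *)

Require Import Defs.
From mathcomp Require Import all_boot all_order all_algebra.
From mathcomp Require Import all_classical all_reals all_analysis.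
From mathcomp Require Import measurable_realfun.
From mathcomp Require Import ring lra zify.

Set Implicit Arguments.
Unset Strict Implicit.
Unset Printing Implicit Defensive.

Import Order.TTheory GRing.Theory Num.Theory.
Import numFieldNormedType.Exports.

Local Open Scope classical_set_scope.
Local Open Scope ring_scope.

(** * Cesàro averages *)

Section averages.
Variable R : realType.
Implicit Types (u v x : nat -> R) (h k m n H N : nat).

Definition avg u N : R := N%:R^-1 * \sum_(0 <= n < N) u n.

Lemma eq_avg u v N : (forall n, (n < N)%N -> u n = v n) -> avg u N = avg v N.
Proof. by move=> uv; congr (_ * _); apply: eq_big_nat => n /andP[_ /uv]. Qed.

Lemma avgD u v N : avg (fun n => u n + v n) N = avg u N + avg v N.
Proof. by rewrite /avg big_split mulrDr. Qed.

Lemma avgZ c u N : avg (fun n => c * u n) N = c * avg u N.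
Proof. by rewrite /avg -mulr_sumr mulrCA. Qed.

Lemma avgB u v N : avg (fun n => u n - v n) N = avg u N - avg v N.
Proof. by rewrite /avg sumrB mulrBr. Qed.

Lemma avg_cst c N : (0 < N)%N -> avg (fun=> c) N = c.
Proof.
move=> N0; rewrite /avg sumr_const_nat subn0 -[c *+ N]mulr_natl mulrA mulVf ?mul1r//.
by rewrite pnatr_eq0 -lt0n.
Qed.

Lemma ler_avg u v N : (forall n, (n < N)%N -> u n <= v n) -> avg u N <= avg v N.
Proof.
move=> uv; apply: ler_wpM2l; first by rewrite invr_ge0.
by apply: ler_sum_nat => n /andP[_ /uv].
Qed.

Lemma avg_ge0 u N : (forall n, 0 <= u n) -> 0 <= avg u N.
Proof. by move=> u0; rewrite mulr_ge0 ?invr_ge0 ?sumr_ge0. Qed.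

Lemma ler_norm_avg u N : `|avg u N| <= avg (fun n => `|u n|) N.
Proof.
rewrite /avg normrM ger0_norm ?invr_ge0//; apply: ler_wpM2l.
  by rewrite invr_ge0.
exact: ler_norm_sum.
Qed.

Lemma norm_avg_le u (C : R) N : 0 <= C -> (forall n, `|u n| <= C) -> `|avg u N| <= C.
Proof.
move=> C0 uC; have [->|N0] := posnP N.
  by rewrite /avg big_geq// mulr0 normr0.
by rewrite (le_trans (ler_norm_avg _ _))// -[leRHS](avg_cst _ N0) ler_avg.
Qed.

Lemma exchange_avg (r : nat -> nat -> R) H N :
  avg (fun h => avg (r h) N) H = avg (fun n => avg (r^~ n) H) N.
Proof. by rewrite /avg -!mulr_sumr exchange_big/= mulrCA. Qed.

(** The variance is nonnegative. *)
Lemma sqr_avg_le u N : (avg u N) ^+ 2 <= avg (fun n => u n ^+ 2) N.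
Proof.
have [->|N0] := posnP N; first by rewrite /avg !big_geq// !mulr0 expr0n.
have : 0 <= avg (fun n => (u n - avg u N) ^+ 2) N by apply: avg_ge0 => n; exact: sqr_ge0.
rewrite (_ : avg _ N = avg (fun n => u n ^+ 2 - ((2 * avg u N) * u n - avg u N ^+ 2)) N).
  by rewrite !avgB avgZ avg_cst// => ?; nra.
by apply: eq_avg => n _; ring.
Qed.

Lemma sqr_avg u N :
  (avg u N) ^+ 2 = avg (fun h => avg (fun k => u h * u k) N) N.
Proof.
transitivity (avg (fun h => avg u N * u h) N); first by rewrite avgZ expr2.
by apply: eq_avg => n _; rewrite avgZ mulrC.
Qed.

(** A shift by one drops one term of the sum and gains another, a change of at most [2 * C]; this is
    repeated [h] times. *)
Lemma avg_shift_le u (C : R) h N : (forall n, `|u n| <= C) ->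
  `|avg (fun n => u (n + h)%N) N - avg u N| <= 2 * h%:R * C / N%:R.
Proof.
move=> uC; rewrite /avg -mulrBr normrM ger0_norm ?invr_ge0// mulrC.
apply: ler_wpM2r; first by rewrite invr_ge0.
elim: h => [|h IH].
  by under eq_bigr do rewrite addn0; rewrite subrr normr0 mulr0 mul0r.
have -> : \sum_(0 <= n < N) u (n + h.+1)%N =
    \sum_(0 <= n < N) u (n + h)%N + (u (N + h)%N - u h).
  elim: N {IH} => [|N IHN]; first by rewrite !big_geq// add0n subrr addr0.
  by rewrite !big_nat_recr//= IHN addnS addSn; ring.
rewrite addrAC; apply: le_trans (ler_normD _ _) _.
have := ler_normB (u (N + h)%N) (u h); have := uC (N + h)%N; have := uC h.
by move: IH; rewrite -[h.+1%:R]natr1; lra.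
Qed.

(** The terms at multiples of [c] are among the first [c * N] terms, all nonnegative; the factor [c]
    comes from the normalisation. *)
Lemma avg_subseq_le u c N : (0 < c)%N -> (forall n, 0 <= u n) ->
  avg (fun n => u (c * n)%N) N <= c%:R * avg u (c * N)%N.
Proof.
move=> c0 u0; rewrite /avg natrM invfM mulrA mulrA divff ?mul1r; last first.
  by rewrite pnatr_eq0 -lt0n.
apply: ler_wpM2l; first by rewrite invr_ge0.
elim: N => [|N IH]; first by rewrite muln0 !big_geq.
rewrite big_nat_recr//= mulnS addnC [leRHS](big_cat_nat _ (n := (c * N)%N))//= ?leq_addr//.
apply: lerD => //; rewrite big_ltn; last by lia.
by rewrite lerDl sumr_ge0.
Qed.

(* The difference between the mean and the doubly averaged mean is a boundary
   term of size [O(H / N)]. *)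
Lemma van_der_corput x (C : R) H N : (0 < H)%N -> 0 <= C ->
  (forall n, `|x n| <= C) ->
  (avg x N) ^+ 2 <= 2 * avg (fun n => (avg (fun h => x (n + h)%N) H) ^+ 2) N
                    + 2 * (2 * H%:R * C / N%:R) ^+ 2.
Proof.
move=> H0 C0 xC.
set a := avg (fun n => avg (fun h => x (n + h)%N) H) N.
have a2 : a ^+ 2 <= avg (fun n => (avg (fun h => x (n + h)%N) H) ^+ 2) N.
  exact: sqr_avg_le.
have e : `|a - avg x N| <= 2 * H%:R * C / N%:R.
  rewrite /a exchange_avg -[avg x N](avg_cst _ H0) -avgB.
  apply: le_trans (ler_norm_avg _ _) _; rewrite -[leRHS](avg_cst _ H0).
  apply: ler_avg => h hH; apply: le_trans (avg_shift_le _ _ xC) _.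
  rewrite ler_wpM2r ?invr_ge0// ler_wpM2r// ler_wpM2l// ler_nat.
  exact: ltnW.
(* With [X] for [avg x N], [2 a^2 + 2 (a - X)^2 - X^2 = (2 a - X)^2]. *)
have := sqr_ge0 (2 * a - avg x N).
have : (a - avg x N) ^+ 2 <= (2 * H%:R * C / N%:R) ^+ 2.
  by rewrite -real_normK ?num_real// ler_sqr ?nnegrE ?(le_trans _ e).
by move: a2; nra.
Qed.

(** [rho k] bounds the entries at distance [k] from the diagonal, and the square of side [H] has at
    most [2 * H] of these. The induction adds the last row and column. *)
Lemma avg_diagonal_le (r : nat -> nat -> R) (rho : nat -> R) H :
  (forall h k, r h k = r k h) -> (forall k, 0 <= rho k) ->
  (forall h k, (h + k < H)%N -> r h (h + k)%N <= rho k) ->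
  avg (fun h => avg (r h) H) H <= 2 * avg rho H.
Proof.
move=> rC rho0 rrho.
have [->|H0] := posnP H; first by rewrite /avg !big_geq// !mulr0.
suff : \sum_(0 <= h < H) \sum_(0 <= k < H) r h k <=
    2 * H%:R * \sum_(0 <= k < H) rho k.
  move=> le_sum; rewrite /avg -mulr_sumr.
  have Hp : (0 : R) < H%:R by rewrite ltr0n.
  rewrite mulrA -invfM mulrC ler_pdivrMr ?mulr_gt0//.
  rewrite (le_trans le_sum)// le_eqVlt; apply/orP; left; apply/eqP.
  by field; rewrite gt_eqF.
clear H0; elim: H rrho => [|H IH] rrho; first by rewrite big_geq// mulr0 mul0r.
have {}IH := IH (fun h k hk => rrho h k (ltnW hk)).
rewrite big_nat_recr//= (big_nat_recr _ _ (r H))//=.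
under eq_bigr do rewrite big_nat_recr//=.
rewrite big_split/=.
have -> : \sum_(0 <= i < H) r H i = \sum_(0 <= i < H) r i H.
  by apply: eq_bigr => i _; exact: rC.
have rH : \sum_(0 <= i < H) r i H <= \sum_(0 <= i < H) rho i.+1.
  rewrite [leRHS]big_nat_rev/= add0n; apply: ler_sum_nat => i /andP[_ iH].
  have -> : (H - i.+1).+1 = (H - i)%N by lia.
  have := rrho i (H - i)%N; rewrite subnKC; last exact: ltnW.
  exact.
have rHH : r H H <= rho 0%N by have := rrho H 0%N; rewrite addn0 ltnSn; exact.
have Srec : \sum_(0 <= k < H.+1) rho k = rho 0%N + \sum_(0 <= i < H) rho i.+1.
  by rewrite big_nat_recl.
have Srecr : \sum_(0 <= k < H.+1) rho k = \sum_(0 <= i < H) rho i + rho H.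
  by rewrite big_nat_recr.
have rH0 := rho0 H; have r00 := rho0 0%N.
have HR : (0 : R) <= H%:R by [].
rewrite -[H.+1%:R]natr1; move: IH; rewrite -/(\sum_(0 <= h < H) _).
set S1 := \sum_(0 <= h < H) \sum_(0 <= k < H) r h k.
rewrite Srecr in Srec *.
move: rH rHH Srec; set A := \sum_(0 <= k < H) rho k; set B := \sum_(0 <= i < H) rho i.+1.
set D := \sum_(0 <= i < H) r i H => *; nra.
Qed.

(** The limit in [N] is taken first, with [H] fixed, so that boundary terms of size [O(H / N)]
    vanish; only then does [H] grow. *)
Lemma squeeze_iterated (y : nat -> R) (b : nat -> nat -> R) (beta : nat -> R) :
  (forall N, 0 <= y N) ->
  (forall H N, (0 < H)%N -> (0 < N)%N -> y N <= b H N) ->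
  (forall H, (0 < H)%N -> b H @ \oo --> beta H) ->
  beta @ \oo --> 0 -> y @ \oo --> 0.
Proof.
move=> y0 yb bbeta beta0; apply/cvgrPdist_lt => e e0.
have e20 : 0 < e / 2 by rewrite divr_gt0.
have [H H0 betaH] : exists2 H, (0 < H)%N & beta H < e / 2.
  move/cvgrPdist_lt : beta0 => /(_ _ e20)[M _ MP]; exists M.+1 => //.
  have := MP M.+1 (leqnSn _); rewrite /= sub0r normrN => /ltr_normlW; exact.
have /cvgrPdist_lt/(_ _ e20)[M _ MP] := bbeta H H0.
exists M.+1 => //= N MN; rewrite sub0r normrN ger0_norm//.
apply: le_lt_trans (yb H N H0 _) _; first by apply: leq_trans MN.
have := MP N (ltnW MN); rewrite /= distrC => /ltr_normlW; lra.
Qed.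

End averages.

(** * Multiple mixing of sequences *)

(** [lim] is meaningful only where the averages converge; [mixing_cvg] ensures this inside a mixing
    algebra. *)
Definition mean (R : realType) (u : nat -> R) : R := lim (avg u @ \oo).

(** Abstracts the sequences [n |-> f (T^n xi)], with [f] continuous and [xi] generic, to what the
    combinatorial argument needs. [mixing_corr] is the trace of weak mixing: correlations of a
    sequence of mean zero tend to [0] in density. *)
Record mixing_algebra (R : realType) (S : set (nat -> R)) : Prop := {
  mixing_cst : forall c, S (fun=> c) ;
  mixingD : forall u v, S u -> S v -> S (fun n => u n + v n) ;
  mixingM : forall u v, S u -> S v -> S (fun n => u n * v n) ;
  mixingS : forall u, S u -> S (fun n => u n.+1) ;
  mixing_bounded : forall u, S u -> exists C, forall n, `|u n| <= C ;
  mixing_cvg : forall u, S u -> cvg (avg u @ \oo) ;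
  mixing_corr : forall u, S u -> mean u = 0 ->
    avg (fun h => `|mean (fun n => u n * u (n + h)%N)|) @ \oo --> 0
}.

Section mixing_algebra_theory.
Variables (R : realType) (S : set (nat -> R)) (mS : mixing_algebra S).
Implicit Types (u v : nat -> R).

Lemma mixing_shift u h : S u -> S (fun n => u (n + h)%N).
Proof.
move=> Su; elim: h => [|h /(mixingS mS)].
  by under eq_fun do rewrite addn0.
by under eq_fun do rewrite addSnnS.
Qed.

Lemma mixingZ c u : S u -> S (fun n => c * u n).
Proof. by move=> Su; apply: (mixingM mS) => //; exact: mixing_cst. Qed.

Lemma mixingB u v : S u -> S v -> S (fun n => u n - v n).
Proof.
move=> Su Sv; under eq_fun do rewrite -mulN1r.
by apply: (mixingD mS) => //; exact: mixingZ.
Qed.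

Lemma mixing_sum (w : nat -> nat -> R) (r : seq nat) :
  (forall i, S (w i)) -> S (fun n => \sum_(i <- r) w i n).
Proof.
move=> Sw; elim: r => [|i r IH].
  by under eq_fun do rewrite big_nil; exact: mixing_cst.
by under eq_fun do rewrite big_cons; exact: mixingD.
Qed.

Lemma mixing_prod (w : nat -> nat -> R) (r : seq nat) :
  (forall i, S (w i)) -> S (fun n => \prod_(i <- r) w i n).
Proof.
move=> Sw; elim: r => [|i r IH].
  by under eq_fun do rewrite big_nil; exact: mixing_cst.
by under eq_fun do rewrite big_cons; exact: mixingM.
Qed.

Lemma mixing_avg (w : nat -> nat -> R) N :
  (forall i, S (w i)) -> S (fun n => avg (w^~ n) N).
Proof. by move=> Sw; apply: mixingZ; exact: mixing_sum. Qed.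

Lemma cvg_mean u : S u -> avg u @ \oo --> mean u.
Proof. exact: (mixing_cvg mS). Qed.

Lemma mean_eq u l : avg u @ \oo --> l -> mean u = l.
Proof. by move=> /cvg_lim; apply. Qed.

Lemma meanD u v : S u -> S v -> mean (fun n => u n + v n) = mean u + mean v.
Proof.
move=> Su Sv; apply: mean_eq; rewrite (_ : avg _ = avg u \+ avg v).
  by apply: cvgD; exact: cvg_mean.
by apply/funext => N; exact: avgD.
Qed.

Lemma meanZ c u : S u -> mean (fun n => c * u n) = c * mean u.
Proof.
move=> Su; apply: mean_eq; rewrite (_ : avg _ = (fun N => c * avg u N)).
  by apply: cvgMr; exact: cvg_mean.
by apply/funext => N; exact: avgZ.
Qed.

Lemma meanB u v : S u -> S v -> mean (fun n => u n - v n) = mean u - mean v.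
Proof.
move=> Su Sv; rewrite -[- mean v]mulN1r -meanZ// -meanD//; last exact: mixingZ.
by under eq_fun do rewrite -mulN1r.
Qed.

Lemma mean_cst (c : R) : mean (fun=> c) = c.
Proof.
apply: mean_eq; apply/cvgrPdist_lt => e e0; exists 1%N => // N /= N0.
by rewrite avg_cst// subrr normr0.
Qed.

Lemma ler_mean u v : S u -> S v -> (forall n, u n <= v n) -> mean u <= mean v.
Proof.
move=> Su Sv uv; apply: ler_lim; [exact: (mixing_cvg mS Su)|exact: (mixing_cvg mS Sv)|].
by apply: nearW => N; exact: ler_avg.
Qed.

Lemma cvg_divn (c : R) : (fun N : nat => c / N%:R) @ \oo --> 0.
Proof.
rewrite -cvg_shiftS.
suff : (fun N => c * (N.+1%:R)^-1) @ \oo --> c * 0 by rewrite mulr0.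
by apply: cvgMr; exact: cvg_harmonic.
Qed.

Lemma cvg_avg_shift u (C l : R) h : (forall n, `|u n| <= C) ->
  avg u @ \oo --> l -> avg (fun n => u (n + h)%N) @ \oo --> l.
Proof.
move=> uC ul.
rewrite (_ : avg _ = (fun N => (avg (fun n => u (n + h)%N) N - avg u N) + avg u N)).
  rewrite -[l]add0r; apply: cvgD ul.
  apply: norm_cvg0; apply: squeeze_cvgr (cvg_cst 0) (cvg_divn (2 * h%:R * C)).
  by apply: nearW => N; rewrite normr_ge0/= avg_shift_le.
by apply/funext => N; rewrite subrK.
Qed.

Lemma mean_shift u h : S u -> mean (fun n => u (n + h)%N) = mean u.
Proof.
move=> Su; apply: mean_eq; have [C uC] := mixing_bounded mS Su.
by apply: cvg_avg_shift uC _; exact: cvg_mean.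
Qed.

Lemma mean_sum (w : nat -> nat -> R) (r : seq nat) : (forall i, S (w i)) ->
  mean (fun n => \sum_(i <- r) w i n) = \sum_(i <- r) mean (w i).
Proof.
move=> Sw; elim: r => [|i r IH].
  by under eq_fun do rewrite big_nil; rewrite big_nil mean_cst.
rewrite big_cons -IH -meanD//; last exact: mixing_sum.
by under eq_fun do rewrite big_cons.
Qed.

Lemma mean_avg (w : nat -> nat -> R) N : (forall i, S (w i)) ->
  mean (fun n => avg (w^~ n) N) = avg (fun i => mean (w i)) N.
Proof. by move=> Sw; rewrite meanZ ?mean_sum//; exact: mixing_sum. Qed.

Lemma mean_bound u (C : R) : S u -> (forall n, `|u n| <= C) -> `|mean u| <= C.
Proof.
move=> Su uC; rewrite ler_norml; apply/andP; split.
  rewrite -[- C]mean_cst; apply: ler_mean => [||n] //; first exact: mixing_cst.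
  by have := uC n; rewrite ler_norml => /andP[].
rewrite -[C in leRHS]mean_cst; apply: ler_mean => [||n] //; first exact: mixing_cst.
by have := uC n; rewrite ler_norml => /andP[].
Qed.

Lemma sqr_mean_le u : S u -> (mean u) ^+ 2 <= mean (fun n => u n ^+ 2).
Proof.
move=> Su; have Suu := mixingM mS Su Su.
have : mean (fun n => (2 * mean u) * u n - mean u ^+ 2) <= mean (fun n => u n * u n).
  apply: ler_mean => // [|n].
    by apply: mixingB; [exact: mixingZ|exact: mixing_cst].
  by have := sqr_ge0 (u n - mean u); nra.
rewrite (meanB (mixingZ _ Su) (mixing_cst mS _)) (meanZ _ Su) mean_cst.
under [in X in _ -> X]eq_fun do rewrite expr2.
by nra.
Qed.

End mixing_algebra_theory.

(** * Averages along multiples of an integer *)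

Section weak_mixing_sequences.
Variables (R : realType) (S : set (nat -> R)) (mS : mixing_algebra S).
Implicit Types (u v : nat -> R).

Lemma sqr_cvg0 u : (fun N => u N ^+ 2) @ \oo --> 0 -> u @ \oo --> 0.
Proof.
move=> u2; apply/cvgrPdist_lt => e e0.
have /cvgrPdist_lt/(_ _ (exprn_gt0 2 e0)) := u2.
apply: filterS => N; rewrite !sub0r !normrN ger0_norm ?sqr_ge0// => le2.
have uN : `|u N| ^+ 2 < e ^+ 2 by rewrite real_normK ?num_real.
by rewrite -(@ltr_pXn2r _ 2) ?nnegrE// ltW.
Qed.

Lemma cvg_boundary (a : R) : (fun N => 2 * (a / N%:R) ^+ 2) @ \oo --> 0.
Proof.
suff : (fun N => 2 * (a / N%:R) ^+ 2) @ \oo --> (2 * (0 * 0) : R) by rewrite !mulr0.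
by apply: cvgMr; under eq_fun do rewrite expr2; apply: cvgM; exact: cvg_divn.
Qed.

Lemma cvg0_scale_subseq (a : R) c u : (0 < c)%N -> u @ \oo --> 0 ->
  (fun N => a * u (c * N)%N) @ \oo --> 0.
Proof.
move=> c0 u0; suff : (fun N => a * u (c * N)%N) @ \oo --> a * 0 by rewrite mulr0.
by apply: cvgMr; exact: (cvg_comp (muln c) u (cvg_mulnl _ c0) u0).
Qed.

Lemma mixing_corr_dilate u c : S u -> mean u = 0 -> (0 < c)%N ->
  avg (fun h => `|mean (fun n => u n * u (n + c * h)%N)|) @ \oo --> 0.
Proof.
move=> Su u0 c0; have := cvg0_scale_subseq c%:R c0 (mixing_corr mS Su u0).
apply: squeeze_cvgr (cvg_cst 0); apply: nearW => N.
rewrite avg_ge0//=.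
exact: (@avg_subseq_le _ (fun h => `|mean (fun n => u n * u (n + h)%N)|)).
Qed.

(** Van der Corput's inequality for [n |-> u (c * n)] leads to the squares [q H] sampled at
    multiples of [c]. Averaging [q H] over all integers instead costs a factor [c], and its mean is
    a double average of correlations of [u] at lags divisible by [c]. *)
Lemma avg_dilate0 u c : S u -> mean u = 0 -> (0 < c)%N ->
  avg (fun n => u (c * n)%N) @ \oo --> 0.
Proof.
move=> Su u0 c0; have [C uC] := mixing_bounded mS Su.
have C0 : 0 <= C by rewrite (le_trans _ (uC 0%N)).
pose q H n := (avg (fun h => u (n + c * h)%N) H) ^+ 2.
have Suh h : S (fun n => u (n + c * h)%N) by exact: (mixing_shift mS).
have Sq H : S (q H).
  rewrite /q; under eq_fun do rewrite expr2.
  have Sa := @mixing_avg _ _ mS (fun h n => u (n + c * h)%N) H Suh.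
  exact: (mixingM mS).
apply: sqr_cvg0.
apply: (@squeeze_iterated _ _
  (fun H N => 2 * c%:R * avg (q H) (c * N)%N + 2 * (2 * H%:R * C / N%:R) ^+ 2)
  (fun H => 2 * c%:R * mean (q H))).
- by move=> N; exact: sqr_ge0.
- move=> H N H0 N0.
  apply: le_trans (van_der_corput _ H0 C0 (fun n => uC (c * n)%N)) _.
  rewrite lerD2r -mulrA ler_wpM2l//.
  apply: le_trans (avg_subseq_le _ c0 (fun n => sqr_ge0 _)); apply: ler_avg => n _.
  by rewrite /q le_eqVlt; apply/orP; left; apply/eqP; congr (_ ^+ 2);
    apply: eq_avg => h _; rewrite mulnDr.
- move=> H H0; rewrite -[_ * mean _]addr0; apply: cvgD; last exact: cvg_boundary.
  by apply: cvgMr; exact: (cvg_comp (muln c) _ (cvg_mulnl _ c0) (cvg_mean mS (Sq H))).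
(* The dilation is by [1], so only the factor [4 * c] matters: [2 * c] is already in the bound, and
   [2] comes from the two sides of the diagonal. *)
have /(cvg0_scale_subseq (4 * c%:R) (ltn0Sn 0)) := mixing_corr_dilate Su u0 c0.
apply: squeeze_cvgr (cvg_cst 0); apply: nearW => H; apply/andP; split.
  rewrite !mulr_ge0// -[leLHS](@mean_cst R); apply: (ler_mean mS) => //.
    exact: (mixing_cst mS).
  by move=> n; exact: sqr_ge0.
set X := avg _ (1 * H)%N.
rewrite (_ : 4 * c%:R * X = 2 * c%:R * (2 * X)); last by ring.
rewrite ler_wpM2l ?mulr_ge0// /X mul1n.
have -> : mean (q H) = avg (fun h => avg (fun k =>
    mean (fun n => u (n + c * h)%N * u (n + c * k)%N)) H) H.
  rewrite /q; under eq_fun do rewrite sqr_avg.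
  pose w h k n := u (n + c * h)%N * u (n + c * k)%N.
  have Sw h k : S (w h k) by exact: (mixingM mS).
  rewrite (@mean_avg _ _ mS (fun h n => avg (fun k => w h k n) H)); last first.
    by move=> h; exact: (@mixing_avg _ _ mS (w h)).
  by apply: eq_avg => h _; exact: (@mean_avg _ _ mS (w h)).
apply: avg_diagonal_le => //.
  by move=> h k; congr mean; apply/funext => n; exact: mulrC.
move=> h k _; rewrite (le_trans (ler_norm _))// le_eqVlt; apply/orP; left.
rewrite -(mean_shift mS (c * h) (mixingM mS Su (Suh k))); apply/eqP.
by congr (`|mean _|); apply/funext => n; rewrite mulnDr addnA.
Qed.

Lemma avg_dilate u c : S u -> (0 < c)%N ->
  avg (fun n => u (c * n)%N) @ \oo --> mean u.
Proof.
move=> Su c0; have Sm := mixing_cst mS (mean u).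
have := @avg_dilate0 (fun n => u n - mean u) c (mixingB mS Su Sm).
rewrite (meanB mS)// mean_cst subrr => /(_ erefl c0) /cvgrPdist_lt lim0.
apply/cvgrPdist_lt => e /lim0; move=> near_e; near=> N.
have N0 : (0 < N)%N by near: N; exists 1%N.
by rewrite -normrN opprB -[mean u](@avg_cst R _ N)// -avgB -normrN -sub0r; near: N.
Unshelve. all: by end_near. Qed.

End weak_mixing_sequences.

(** * Weak mixing of all orders *)

Section multiple_mixing.
Variables (R : realType) (S : set (nat -> R)) (mS : mixing_algebra S).

(** The correlation of [k] sequences along the progression [m, m + n, ..., m + (k - 1) n], averaged
    over [m]. *)
Definition multiple_corr (u : nat -> nat -> R) k n : R :=
  mean (fun m => \prod_(0 <= l < k) u l (m + l * n)%N).

Definition mixing_of_order k := forall u : nat -> nat -> R, (forall l, S (u l)) ->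
  avg (fun n => `|multiple_corr u k n - \prod_(0 <= l < k) mean (u l)|) @ \oo --> 0.

Lemma prod_bound (x C : nat -> R) (r : seq nat) : (forall l, `|x l| <= C l) ->
  `|\prod_(l <- r) x l| <= \prod_(l <- r) C l.
Proof. by move=> xC; rewrite normr_prod ler_prod// => l _; rewrite normr_ge0 xC. Qed.

(** Cauchy-Schwarz in [m] removes [u 0], and van der Corput in [n] replaces the other factors by
    products of two of their translates. These are correlations of order [k + 1], so by hypothesis
    they approach the products [g j] of means; the last factor of [g j] is a correlation of
    [u k.+1], which tends to [0] in density. *)
Lemma multiple_corr_cvg0 k (u : nat -> nat -> R) : mixing_of_order k.+1 ->
  (forall l, S (u l)) -> mean (u k.+1) = 0 ->
  avg (fun n => `|multiple_corr u k.+2 n|) @ \oo --> 0.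
Proof.
move=> mixk Su uk0.
have /choice[C uC] : forall l, exists c, forall n, `|u l n| <= c.
  move=> l; by have [c] := mixing_bounded mS (Su l); exists c.
have C0 l : 0 <= C l by rewrite (le_trans _ (uC l 0%N)).
pose W n m := \prod_(0 <= l < k.+1) u l.+1 (m + l.+1 * n)%N.
pose D := \prod_(0 <= l < k.+1) C l.+1.
have WD n m : `|W n m| <= D by apply: prod_bound => l.
have D0 : 0 <= D by exact: le_trans (WD 0%N 0%N).
have SW n : S (W n).
  by apply: (mixing_prod mS) => l; exact: (mixing_shift mS).
pose x n := multiple_corr u k.+2 n.
have xE n : x n = mean (fun m => u 0%N m * W n m).
  rewrite /x /multiple_corr; congr mean; apply/funext => m.
  by rewrite big_nat_recl// mul0n addn0.
have sgx n : `|Num.sg (x n)| <= 1 by rewrite normr_sg; case: (x n != 0).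
(* The sign absorbs the absolute value, so that the average of [|x n|] is the mean of [u 0] times an
   average of [V]. *)
pose V n m := Num.sg (x n) * W n m.
have SV n : S (V n) by exact: (mixingZ mS).
have VD n m : `|V n m| <= D.
  by rewrite normrM (le_trans _ (WD n m))// ler_piMl.
pose v j l m := u l.+1 m * u l.+1 (m + l.+1 * j)%N.
have Sv j l : S (v j l) by apply: (mixingM mS) => //; exact: (mixing_shift mS).
have vC j l n : `|v j l n| <= C l.+1 * C l.+1 by rewrite normrM ler_pM.
pose B := \prod_(0 <= l < k.+1) (C l.+1 * C l.+1).
pose g j := \prod_(0 <= l < k.+1) mean (v j l).
pose r h h' N := avg (fun n => `|mean (fun m => W (n + h)%N m * W (n + h')%N m)|) N.
pose e j h N := avg (fun n => `|multiple_corr (v j) k.+1 (n + h)%N - g j|) N.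
have e0 j h : e j h @ \oo --> 0.
  apply: (@cvg_avg_shift _ (fun n => `|multiple_corr (v j) k.+1 n - g j|) (B + B)).
    move=> n; rewrite normr_id (le_trans (ler_normB _ _))// lerD//.
      apply: (mean_bound mS) => [|m].
        by apply: (mixing_prod mS) => l; exact: (mixing_shift mS).
      by apply: prod_bound => l; exact: vC.
    by apply: prod_bound => l; apply: (mean_bound mS) => // n; exact: vC.
  exact: mixk.
(* The errors for all [h < H] are added up, so that the bound depends only on the distance [j] to
   the diagonal. *)
pose rho H j N := `|g j| + \sum_(0 <= h < H) e j h N.
apply: sqr_cvg0.
apply: (@squeeze_iterated _ _
  (fun H N => C 0%N ^+ 2 *
    (2 * (2 * avg (fun j => rho H j N) H) + 2 * (2 * H%:R * D / N%:R) ^+ 2))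
  (fun H => C 0%N ^+ 2 * (2 * (2 * avg (fun j => `|g j|) H)))).
- by move=> N; exact: sqr_ge0.
- move=> H N H0 N0.
  have rho0 j : 0 <= rho H j N.
    by rewrite addr_ge0// sumr_ge0// => h _; exact: avg_ge0.
  have rrho : avg (fun h => avg (fun h' => r h h' N) H) H <= 2 * avg (fun j => rho H j N) H.
    apply: avg_diagonal_le => // [h h'|h j hjH].
      apply: eq_avg => n _; congr (`|mean _|).
      by apply/funext => m; exact: mulrC.
    apply: (@le_trans _ _ (`|g j| + e j h N)).
      rewrite -[`|g j|](@avg_cst R _ N)// -avgD; apply: ler_avg => n _.
      suff -> : mean (fun m => W (n + h)%N m * W (n + (h + j))%N m) =
          multiple_corr (v j) k.+1 (n + h)%N.
        by rewrite addrC -{1}(subrK (g j) (multiple_corr _ _ _)) ler_normD.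
      (* Translating [m] by [n + h] turns [m + l (n + h)] into [m + (l + 1) (n + h)]. *)
      rewrite -[RHS](mean_shift mS (n + h)%N); last first.
        by apply: (mixing_prod mS) => l; exact: (mixing_shift mS).
      congr mean; apply/funext => m; rewrite -big_split/=.
      apply: eq_bigr => l _; rewrite /v; congr (u _ _ * u _ _); lia.
    have hH : (h < H)%N by apply: leq_ltn_trans hjH; exact: leq_addr.
    rewrite lerD2l [leRHS](bigD1_seq h) ?iota_uniq//=; last first.
      by rewrite mem_index_iota hH.
    by rewrite lerDl sumr_ge0// => i _; exact: avg_ge0.
  have SZ : S (fun m => avg (V^~ m) N) by exact: (mixing_avg mS).
  have -> : avg (fun n => `|x n|) N = mean (fun m => u 0%N m * avg (V^~ m) N).
    transitivity (avg (fun n => mean (fun m => u 0%N m * V n m)) N).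
      apply: eq_avg => n _; rewrite normrEsg xE -(meanZ mS) -?xE; last exact: (mixingM mS).
      by congr mean; apply/funext => m; rewrite /V mulrCA.
    rewrite -(@mean_avg _ _ mS (fun n m => u 0%N m * V n m)); last first.
      by move=> n; exact: (mixingM mS).
    by congr mean; apply/funext => m; rewrite avgZ.
  (* From here on [u 0] enters only through its bound [C 0]. *)
  apply: (le_trans (sqr_mean_le mS (mixingM mS (Su 0%N) SZ))).
  pose VV n h h' m := V (n + h)%N m * V (n + h')%N m.
  have SVV n h h' : S (VV n h h') by exact: (mixingM mS).
  have SVV1 n h : S (fun m => avg (fun h' => VV n h h' m) H).
    exact: (@mixing_avg _ _ mS (VV n h)).
  have SVV2 n : S (fun m => avg (fun h => avg (fun h' => VV n h h' m) H) H).
    exact: (@mixing_avg _ _ mS (fun h m => avg (fun h' => VV n h h' m) H)).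
  pose Q m := avg (fun n => avg (fun h => avg (fun h' => VV n h h' m) H) H) N.
  have SQ : S Q.
    exact: (@mixing_avg _ _ mS (fun n m => avg (fun h => avg (fun h' => VV n h h' m) H) H)).
  have meanQ : mean Q <= avg (fun h => avg (fun h' => r h h' N) H) H.
    rewrite (@mean_avg _ _ mS (fun n m =>
      avg (fun h => avg (fun h' => VV n h h' m) H) H))//.
    under [leRHS]eq_avg do rewrite exchange_avg.
    rewrite exchange_avg; apply: ler_avg => n _.
    rewrite (@mean_avg _ _ mS (fun h m => avg (fun h' => VV n h h' m) H))//.
    apply: ler_avg => h _; rewrite (@mean_avg _ _ mS (VV n h))//.
    apply: ler_avg => h' _; rewrite (le_trans (ler_norm _))//.
    (* The signs do not depend on [m]; they leave the mean and are bounded by [1]. *)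
    rewrite (_ : mean _ = Num.sg (x (n + h)%N) * Num.sg (x (n + h')%N) *
      mean (fun m => W (n + h)%N m * W (n + h')%N m)); last first.
      rewrite -(meanZ mS); last exact: (mixingM mS).
      by congr mean; apply/funext => m; rewrite /VV /V mulrACA.
    by rewrite normrM ler_piMl// normrM mulr_ile1.
  set b := 2 * H%:R * D / N%:R.
  apply: (@le_trans _ _ (mean (fun m => C 0%N ^+ 2 * (2 * Q m + 2 * b ^+ 2)))).
    have Sb := mixing_cst mS (2 * b ^+ 2).
    apply: (ler_mean mS).
    - under eq_fun do rewrite expr2; apply: (mixingM mS); exact: (mixingM mS).
    - by apply/(mixingZ mS)/(mixingD mS) => //; exact: (mixingZ mS).
    - move=> m; rewrite exprMn ler_pM ?sqr_ge0//.
        by rewrite -(real_normK (num_real (u 0%N m))) ler_sqr ?nnegrE.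
      apply: le_trans (van_der_corput _ H0 D0 (fun n => VD n m)) _.
      rewrite lerD2r ler_wpM2l// le_eqVlt; apply/orP; left; apply/eqP.
      by apply: eq_avg => n _; rewrite sqr_avg.
  have Sb := mixing_cst mS (2 * b ^+ 2); have S2Q := mixingZ mS 2 SQ.
  rewrite (meanZ mS _ (mixingD mS S2Q Sb)) (meanD mS S2Q Sb) (meanZ mS _ SQ) mean_cst.
  by rewrite ler_wpM2l ?sqr_ge0// lerD2r ler_wpM2l// (le_trans meanQ).
- move=> H H0; apply: cvgMr; rewrite -[X in _ --> X]addr0.
  apply: cvgD; last exact: cvg_boundary.
  do 3 apply: cvgMr.
  apply: cvg_big => [|j _]; first exact: add_continuous.
  rewrite /rho -[X in _ --> X]addr0.
  apply: cvgD; first exact: cvg_cst.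
  suff : (fun N => \sum_(0 <= h < H) e j h N) @ \oo -->
      \sum_(0 <= h < H) (0 : R) by rewrite big1.
  by apply: cvg_big => [|h _]; [exact: add_continuous|exact: e0].
(* [B'] bounds all the factors of [g j] except the last. *)
pose B' := \prod_(0 <= l < k) (C l.+1 * C l.+1).
have gB j : `|g j| <= B' * `|mean (fun n => u k.+1 n * u k.+1 (n + k.+1 * j)%N)|.
  rewrite /g big_nat_recr//= normrM ler_wpM2r//.
  by apply: prod_bound => l; apply: (mean_bound mS) => // n; exact: vC.
have := mixing_corr_dilate mS (Su k.+1) uk0 (ltn0Sn k).
set c := avg _ => c0.
have : (fun H => C 0%N ^+ 2 * (2 * (2 * (B' * c H)))) @ \oo -->
    C 0%N ^+ 2 * (2 * (2 * (B' * 0))) by do 4 apply: cvgMr.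
rewrite !mulr0; apply: squeeze_cvgr (cvg_cst 0); apply: nearW => H.
rewrite !mulr_ge0 ?sqr_ge0 ?sumr_ge0 ?invr_ge0//=.
by rewrite !ler_wpM2l ?sqr_ge0// -avgZ; exact: ler_avg.
Qed.
End multiple_mixing.

(** * Configurations on the support of a mixing sequence *)

Section mixing_configurations.
Variables (R : realType) (S : set (nat -> R)) (mS : mixing_algebra S).

(** Orders [0] and [1] are identities. Otherwise the last sequence is split into its deviation from
    its mean [M], which contributes [0] in the limit, and the constant [M], which lowers the order
    by one. *)
Lemma mixing_all_orders k : mixing_of_order S k.
Proof.
elim: k => [|[|k] IH] u Su.
- rewrite (_ : avg _ = cst 0); first exact: cvg_cst.
  apply/funext => N; rewrite /avg big1 ?mulr0// => n _.
  rewrite /multiple_corr big_geq//; under eq_fun do rewrite big_geq//.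
  by rewrite mean_cst subrr normr0.
- rewrite (_ : avg _ = cst 0); first exact: cvg_cst.
  apply/funext => N; rewrite /avg big1 ?mulr0// => n _.
  rewrite /multiple_corr big_nat1; under eq_fun do rewrite big_nat1 mul0n addn0.
  by rewrite subrr normr0.
set M := mean (u k.+1); pose u' l := if l == k.+1 then (fun n => u k.+1 n - M) else u l.
have SM : S (fun=> M) by exact: (mixing_cst mS).
have Su' l : S (u' l) by rewrite /u'; case: eqP => // _; exact: (mixingB mS).
have u'0 : mean (u' k.+1) = 0 by rewrite /u' eqxx (meanB mS)// mean_cst subrr.
have lim1 := multiple_corr_cvg0 mS IH Su' u'0.
have lim2 : (fun N => `|M| * avg (fun n =>
    `|multiple_corr u k.+1 n - \prod_(0 <= l < k.+1) mean (u l)|) N) @ \oo -->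
    `|M| * 0 by apply: cvgMr; exact: IH.
have /(_ _) := cvgD lim1 lim2; rewrite mulr0 addr0; apply: squeeze_cvgr (cvg_cst 0).
apply: nearW => N; rewrite avg_ge0//= addrfctE -avgZ -avgD; apply: ler_avg => n _.
suff -> : multiple_corr u k.+2 n = multiple_corr u' k.+2 n + M * multiple_corr u k.+1 n.
  rewrite big_nat_recr//= -/M -normrM.
  by rewrite (le_trans _ (ler_normD _ _))// le_eqVlt; apply/orP; left;
     apply/eqP; congr (`|_|); ring.
have Sprod (w : nat -> nat -> R) j : (forall l, S (w l)) ->
    S (fun m => \prod_(0 <= l < j) w l (m + l * n)%N).
  by move=> Sw; apply: (mixing_prod mS) => l; exact: (mixing_shift mS).
rewrite -(meanZ mS _ (Sprod _ _ Su)) -(meanD mS (Sprod _ _ Su') (mixingZ mS _ (Sprod _ _ Su))).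
congr mean; apply/funext => m; rewrite !(big_nat_recr k.+1)//= {2}/u' eqxx.
rewrite (_ : \prod_(0 <= i < k.+1) u' i (m + i * n)%N =
  \prod_(0 <= i < k.+1) u i (m + i * n)%N); first by ring.
apply: eq_big_nat => i /andP[_ ik]; rewrite /u' ifN//.
by rewrite neq_ltn ik.
Qed.

(** If one of the two factors vanished for every [n], then, as the correlations tend to [G] in
    density, the averages of [G * b (c * n)] would tend to [0]. They tend to [G * mean b], which is
    nonzero. *)
Lemma exists_return (b : nat -> R) c P : S b -> mean b != 0 -> (0 < c)%N ->
  exists n, b (c * n)%N != 0 /\ multiple_corr (fun=> b) P.+1 n != 0.
Proof.
move=> Sb b0 c0; apply: contrapT => none.
have bmc n : b (c * n)%N * multiple_corr (fun=> b) P.+1 n = 0.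
  apply/eqP; apply: contrapT => /negP; rewrite mulf_eq0 negb_or => /andP[? ?].
  by apply: none; exists n.
have [C bC] := mixing_bounded mS Sb.
pose G := \prod_(0 <= l < P.+1) mean b.
have lim1 : (fun N => C * avg (fun n => `|multiple_corr (fun=> b) P.+1 n - G|) N)
    @ \oo --> C * 0 by apply: cvgMr; exact: (@mixing_all_orders P.+1 (fun=> b)).
have lim2 : (fun N => G * avg (fun n => b (c * n)%N) N) @ \oo --> G * mean b.
  by apply: cvgMr; exact: (avg_dilate mS).
have lim3 : (fun N => G * avg (fun n => b (c * n)%N) N) @ \oo --> 0.
  apply: norm_cvg0; move: lim1; rewrite mulr0; apply: squeeze_cvgr (cvg_cst 0).
  apply: nearW => N; rewrite normr_ge0/= -!avgZ (le_trans (ler_norm_avg _ _))//.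
  apply: ler_avg => n _.
  rewrite (_ : G * _ = b (c * n)%N * (G - multiple_corr (fun=> b) P.+1 n)).
    by rewrite normrM distrC ler_wpM2r.
  by rewrite mulrBr bmc subr0 mulrC.
have /eqP : G * mean b = 0 by rewrite -(cvg_lim _ lim2)// (cvg_lim _ lim3).
by rewrite mulf_eq0 (negbTE b0) orbF /G prodf_seq_eq0 => /hasP[l _]; rewrite (negbTE b0).
Qed.

Lemma exists_configuration (a : nat -> R) c P m :
  S a -> mean a != 0 -> (0 < c)%N ->
  exists y : nat -> nat, forall i, (i < m)%N -> forall l : nat -> nat,
    (forall j, (l j <= P)%N) ->
    a (c * y i + \sum_(0 <= j < i) l j * y j)%N != 0.
Proof.
move=> Sa a0 c0.
(* The induction also carries a sequence [b] whose support consists of admissible starting points: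
   if [b n] is nonzero, so is [a] at every bounded combination of the chosen [y j] added to [n]. *)
suff [y [b [_ _ _ yP]]] : exists y b, [/\ S b, mean b != 0,
    forall n, b n != 0 -> forall l : nat -> nat, (forall j, (l j <= P)%N) ->
      a (n + \sum_(0 <= j < m) l j * y j)%N != 0 &
    forall i, (i < m)%N -> forall l : nat -> nat, (forall j, (l j <= P)%N) ->
      a (c * y i + \sum_(0 <= j < i) l j * y j)%N != 0] by exists y.
elim: m => [|m [y [b [Sb b0 ba yP]]]].
  by exists (fun=> 0%N), a; split => // n an l _; rewrite big_geq// addn0.
have [n [bn mcn]] := exists_return P Sb b0 c0.
pose y' i := if i == m then n else y i.
have y'E (l : nat -> nat) i : (i <= m)%N ->
    \sum_(0 <= j < i) l j * y' j = (\sum_(0 <= j < i) l j * y j)%N.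
  move=> im; apply: eq_big_nat => j /andP[_ ji]; rewrite /y' ifN//.
  by rewrite neq_ltn (leq_trans ji im).
(* The coefficient of the new value [n] selects one factor of this product, whose mean is nonzero by
   the choice of [n]. *)
exists y', (fun k => \prod_(0 <= l < P.+1) b (k + l * n)%N); split => //.
- by apply: (mixing_prod mS) => l; exact: (mixing_shift mS).
- move=> k; rewrite prodf_seq_neq0 => /allP bk l lP.
  rewrite big_nat_recr//= y'E// {1}/y' eqxx addnCA addnC -addnA addnC -addnA.
  have := bk (l m); rewrite mem_index_iota/= ltnS lP => /(_ isT) {}/ba /(_ l lP).
  by congr (a _ != 0); lia.
- move=> i; rewrite ltnS leq_eqVlt => /predU1P[->|im] l lP.
    by rewrite y'E// /y' eqxx; exact: ba.
  by rewrite y'E ?(ltnW im)// /y' ifN ?neq_ltn ?im//; exact: yP.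
Qed.

End mixing_configurations.

(** * The ergodic theorem for bounded functions *)

Section bounded_measurable.
Context d (Y : measurableType d) (R : realType).
Implicit Types f g : Y -> R.

Definition bounded_measurable f :=
  measurable_fun [set: Y] f /\ exists C, forall y, `|f y| <= C.

Lemma bounded_measurable_cst (c : R) : bounded_measurable (fun=> c).
Proof. by split; [exact: measurable_cst|exists `|c|]. Qed.

Lemma bounded_measurableD f g : bounded_measurable f -> bounded_measurable g ->
  bounded_measurable (fun y => f y + g y).
Proof.
move=> [mf [C fC]] [mg [D gD]]; split; first exact: measurable_funD.
by exists (C + D) => y; rewrite (le_trans (ler_normD _ _))// lerD.
Qed.

Lemma bounded_measurableM f g : bounded_measurable f -> bounded_measurable g ->
  bounded_measurable (fun y => f y * g y).
Proof.
move=> [mf [C fC]] [mg [D gD]]; split; first exact: measurable_funM.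
by exists (C * D) => y; rewrite normrM ler_pM.
Qed.

Lemma bounded_measurable_comp (S : Y -> Y) f : measurable_fun [set: Y] S ->
  bounded_measurable f -> bounded_measurable (fun y => f (S y)).
Proof.
by move=> mS [mf [C fC]]; split; [exact: measurableT_comp|exists C => y].
Qed.

Lemma bounded_measurable_max0 f : bounded_measurable f ->
  bounded_measurable (fun y => Num.max 0 (f y)).
Proof.
move=> [mf [C fC]]; split; first exact: measurable_maxr.
exists C => y; rewrite /Num.max; case: ifP => _; first exact: fC.
by rewrite normr0 (le_trans _ (fC y)).
Qed.

Lemma bounded_measurable_indic (A : set Y) : measurable A ->
  bounded_measurable (\1_A : Y -> R).
Proof.
move=> mA; split; first exact: measurable_indic.
by exists 1 => y; rewrite indicE; case: (y \in A); rewrite ?normr0 ?normr1.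
Qed.

Lemma bounded_measurable_sum (F : nat -> Y -> R) (r : seq nat) :
  (forall i, bounded_measurable (F i)) ->
  bounded_measurable (fun y => \sum_(i <- r) F i y).
Proof.
move=> bF; elim: r => [|i r IH].
  by under eq_fun do rewrite big_nil; exact: bounded_measurable_cst.
by under eq_fun do rewrite big_cons; exact: bounded_measurableD.
Qed.

Lemma measurable_gt f (c : R) : measurable_fun [set: Y] f ->
  measurable [set y | c < f y].
Proof.
move=> mf; rewrite (_ : [set y | _] = setT `&` f @^-1` `]c, +oo[).
  by apply: mf => //; exact: measurable_itv.
by apply/seteqP; split => y /=; rewrite in_itv/= andbT //; case.
Qed.

Variable nu : probability Y R.

Lemma bounded_measurable_integrable f : bounded_measurable f ->
  nu.-integrable [set: Y] (EFin \o f).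
Proof.
move=> [mf [C fC]]; apply: measurable_bounded_integrable => //.
  exact: fin_num_fun_lty.
exists C; split; first exact: num_real.
by move=> x Cx y _; exact: le_trans (fC y) (ltW Cx).
Qed.

Lemma expectD f g : bounded_measurable f -> bounded_measurable g ->
  \int[nu]_y (f y + g y) = \int[nu]_y f y + \int[nu]_y g y.
Proof. by move=> bf bg; rewrite RintegralD//; exact: bounded_measurable_integrable. Qed.

Lemma expectZ (c : R) f : bounded_measurable f ->
  \int[nu]_y (c * f y) = c * \int[nu]_y f y.
Proof. by move=> bf; rewrite RintegralZl//; exact: bounded_measurable_integrable. Qed.

Lemma ler_expect f g : bounded_measurable f -> bounded_measurable g ->
  (forall y, f y <= g y) -> \int[nu]_y f y <= \int[nu]_y g y.
Proof.
by move=> bf bg fg; apply: le_Rintegral => //; exact: bounded_measurable_integrable.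
Qed.

Lemma expect_cst (c : R) : \int[nu]_y c = c.
Proof.
rewrite Rintegral_cst// [X in fine X](_ : _ = 1%E) ?mulr1//.
exact: probability_setT.
Qed.

Lemma expect_sum (F : nat -> Y -> R) (r : seq nat) :
  (forall i, bounded_measurable (F i)) ->
  \int[nu]_y (\sum_(i <- r) F i y) = \sum_(i <- r) \int[nu]_y F i y.
Proof.
move=> bF; elim: r => [|i r IH].
  by under eq_Rintegral do rewrite big_nil; rewrite expect_cst big_nil.
under eq_Rintegral do rewrite big_cons.
by rewrite expectD ?IH ?big_cons//; exact: bounded_measurable_sum.
Qed.

Lemma expect_indic (A : set Y) : measurable A -> \int[nu]_y (\1_A y : R) = fine (nu A).
Proof. by move=> mA; rewrite /Rintegral integral_indic// setIT. Qed.

Lemma expect_comp (S : Y -> Y) f : measurable_fun [set: Y] S ->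
  (forall B, measurable B -> nu (S @^-1` B) = nu B) ->
  bounded_measurable f -> \int[nu]_y f (S y) = \int[nu]_y f y.
Proof.
move=> mS inv bf; rewrite /Rintegral; congr fine.
have [mf _] := bf; have mfE : measurable_fun [set: Y] (EFin \o f).
  exact/measurable_EFinP.
have int_fS : nu.-integrable (S @^-1` [set: Y]) ((EFin \o f) \o S).
  exact: (bounded_measurable_integrable (bounded_measurable_comp mS bf)).
have := integral_pushforward mS mfE int_fS measurableT.
rewrite preimage_setT => <-.
by apply: eq_measure_integral => A mA _; exact: inv.
Qed.

End bounded_measurable.

(** * Maximal inequality and pointwise convergence *)

Section ergodic_averages.
Context d (Y : measurableType d) (R : realType) (nu : probability Y R).
Variable S : Y -> Y.
Hypothesis mS : measurable_fun [set: Y] S.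
Hypothesis invS : forall B, measurable B -> nu (S @^-1` B) = nu B.
Hypothesis ergS : forall B, measurable B -> S @^-1` B = B ->
  nu B = 0%E \/ nu B = 1%E.
Implicit Types f g : Y -> R.

Definition birkhoff_sum g n y := \sum_(0 <= i < n) g (iter i S y).

Lemma birkhoff_sumS g n y :
  birkhoff_sum g n.+1 y = g y + birkhoff_sum g n (S y).
Proof.
rewrite /birkhoff_sum big_nat_recl//; congr (_ + _).
by apply: eq_bigr => i _; rewrite iterSr.
Qed.

Lemma measurable_iter n : measurable_fun [set: Y] (iter n S).
Proof. by elim: n => [|n IH]; [exact: measurable_id|exact: measurableT_comp]. Qed.

Lemma bounded_measurable_iter g n : bounded_measurable g ->
  bounded_measurable (fun y => g (iter n S y)).
Proof. by apply: bounded_measurable_comp; exact: measurable_iter. Qed.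

Lemma bounded_measurable_birkhoff g n : bounded_measurable g ->
  bounded_measurable (birkhoff_sum g n).
Proof.
by move=> bg; apply: bounded_measurable_sum => i; exact: bounded_measurable_iter.
Qed.

(** The maximum of the Birkhoff sums of length [0] to [n], in the recursive form used by Garsia's
    argument. *)
Fixpoint birkhoff_max g n y : R :=
  if n is k.+1 then Num.max 0 (g y + birkhoff_max g k (S y)) else 0.

Lemma bounded_measurable_birkhoff_max g n : bounded_measurable g ->
  bounded_measurable (birkhoff_max g n).
Proof.
move=> bg; elim: n => [|n IH]; first exact: bounded_measurable_cst.
apply: bounded_measurable_max0; apply: bounded_measurableD => //.
exact: bounded_measurable_comp.
Qed.

Lemma birkhoff_max_ge0 g n y : 0 <= birkhoff_max g n y.
Proof. by case: n => [|n]//=; rewrite le_max lexx. Qed.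

Lemma birkhoff_max_nondecreasing g n y :
  birkhoff_max g n y <= birkhoff_max g n.+1 y.
Proof.
elim: n y => [|n IH] y; first exact: birkhoff_max_ge0.
rewrite [leLHS]/= [leRHS]/= -/(birkhoff_max g n.+1 (S y)).
by rewrite ge_max !le_max lexx/= lerD2l IH orbT.
Qed.

Lemma birkhoff_sum_le_max g n y : birkhoff_sum g n y <= birkhoff_max g n y.
Proof.
elim: n y => [|n IH] y; first by rewrite /birkhoff_sum big_geq.
by rewrite birkhoff_sumS /= le_max lerD2l IH orbT.
Qed.

(** Write [M] for [birkhoff_max g n]. Where [M > 0], the next maximum is [g + M o S] and is at least
    [M]; elsewhere [M = 0 <= M o S]. Hence [M <= 1_A g + M o S] everywhere, and the integrals of [M]
    and [M o S] cancel by invariance. *)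
Lemma maximal_ergodic g n : bounded_measurable g ->
  0 <= \int[nu]_y (\1_[set y | 0 < birkhoff_max g n y] y * g y).
Proof.
move=> bg; set A := [set y | _].
have bM := bounded_measurable_birkhoff_max n bg.
have mA : measurable A by apply: measurable_gt; have [] := bM.
have bA := bounded_measurableM (@bounded_measurable_indic _ _ R _ mA) bg.
have bMS := bounded_measurable_comp mS bM.
rewrite -(lerD2r (\int[nu]_y birkhoff_max g n (S y))) add0r -expectD//.
rewrite (expect_comp mS invS bM); apply: ler_expect => //.
  exact: bounded_measurableD.
move=> y; rewrite indicE; case: (ltP 0 (birkhoff_max g n y)) => M0.
  rewrite mem_set// mul1r; have := birkhoff_max_nondecreasing g n y.
  by rewrite /= le_max => /orP[/(lt_le_trans M0)|//]; rewrite ltxx.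
rewrite memNset ?mul0r ?add0r; last by rewrite /A/= => /lt_geF; rewrite M0.
by rewrite (le_trans M0)// birkhoff_max_ge0.
Qed.

(* On [Z], where every [birkhoff_max] vanishes, the sums stay nonpositive; the
   maximal inequality makes [Z] non-null, and ergodicity then kills the
   invariant set of points with unbounded sums, which is disjoint from [Z]. *)
Lemma birkhoff_sum_bounded_ae g : bounded_measurable g -> \int[nu]_y g y < 0 ->
  {ae nu, forall y, exists K : nat, forall n, birkhoff_sum g n y <= K%:R}.
Proof.
move=> bg g0; have [mg [C' gC']] := bg.
have [C C0 gC] : exists2 C : R, 0 < C & forall y, `|g y| <= C.
  exists (`|C'| + 1) => [|y]; first by rewrite ltr_wpDl.
  by rewrite (le_trans (gC' y))// (le_trans (ler_norm _))// lerDl.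
pose A n := [set y | 0 < birkhoff_max g n y].
have mA n : measurable (A n).
  by apply: measurable_gt; have [] := bounded_measurable_birkhoff_max n bg.
have mZ n : measurable (~` A n) by exact: measurableC.
have Zle n : - (\int[nu]_y g y) <= C * fine (nu (~` A n)).
  rewrite -expect_indic// -subr_ge0 opprK [leRHS]addrC.
  have bZ := @bounded_measurable_indic _ _ R _ (mZ n).
  have bCZ := bounded_measurableM (bounded_measurable_cst Y C) bZ.
  rewrite -expectZ// -expectD//; apply: le_trans (maximal_ergodic n bg) _.
  apply: ler_expect.
  - exact: (bounded_measurableM (bounded_measurable_indic R (mA n)) bg).
  - exact: bounded_measurableD.
  move=> y; rewrite !indicE in_setC; case: (y \in _) => /=.
    by rewrite mul1r mulr0 addr0.
  by rewrite mul0r mulr1 -lerBlDr sub0r; have := gC y; rewrite ler_norml => /andP[].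
pose E := [set y | forall K : nat, exists n, K%:R < birkhoff_sum g n y].
have EE : E = \bigcap_K \bigcup_n [set y | K%:R < birkhoff_sum g n y].
  apply/seteqP; split => y Ey K; first by move=> _; have [n] := Ey K; exists n.
  by have [n _] := Ey K I; exists n.
have mE : measurable E.
  rewrite EE; apply: bigcapT_measurable => K; apply: bigcupT_measurable => n.
  by apply: measurable_gt; have [] := bounded_measurable_birkhoff n bg.
have SE : S @^-1` E = E.
  (* Passing between [y] and [S y] changes a sum by one term, of size at most [C]; raising the
     threshold by an integer above [C] absorbs it. *)
  have CK (K : nat) : K%:R + C < (K + (Num.truncn C).+1)%:R.
    by rewrite natrD ltrD2l truncnS_gt.
  apply/seteqP; split => y /= Ey K.
    have [n] := Ey (K + (Num.truncn C).+1)%N; exists n.+1.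
    rewrite birkhoff_sumS; have := CK K; have := gC y.
    by rewrite ler_norml => /andP[]; lra.
  have [[|n]] := Ey (K + (Num.truncn C).+1)%N.
    by rewrite /birkhoff_sum big_geq// ltrn0.
  rewrite birkhoff_sumS; exists n; have := CK K; have := gC y.
  by rewrite ler_norml => /andP[]; lra.
have E0 : nu E = 0%E.
  have [//|E1] := ergS mE SE.
  pose Z := \bigcap_n ~` A n.
  have mZZ : measurable Z by exact: bigcapT_measurable.
  have Z0 : nu Z = 0%E.
    have cE0 : nu (~` E) = 0%E by rewrite probability_setC// E1 subee.
    apply: (subset_measure0 mZZ (measurableC mE) _ cE0).
    move=> y Zy Ey; have [n] := Ey 0%N; rewrite ltNge => /negP; apply.
    rewrite (le_trans (birkhoff_sum_le_max g n y))// leNgt.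
    by apply/negP; exact: Zy n I.
  have nuZ : nu (~` A n) @[n --> \oo] --> nu Z.
    apply: nonincreasing_cvg_mu => //.
      by rewrite (le_lt_trans (probability_le1 _ _))// ltry.
    apply/nonincreasing_seqP => n; apply/subsetPset/subsetC => y.
    by move=> /lt_le_trans; apply; exact: birkhoff_max_nondecreasing.
  have : ((- (\int[nu]_y g y) / C)%:E <= nu Z)%E.
    rewrite -(cvg_lim _ nuZ)//; apply: lime_ge; first by apply/cvg_ex; exists (nu Z).
    apply: nearW => n; rewrite -[leRHS]fineK ?fin_num_measure//.
    by rewrite lee_fin ler_pdivrMr// mulrC.
  by rewrite Z0 lee_fin ler_pdivrMr// mul0r oppr_le0 leNgt g0.
exists E; split => //= y; rewrite /E /= => /forallNP yK K.
have /existsNP[n /negP] := yK K.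
by rewrite -ltNge => ?; exists n.
Qed.

(** Both [f - 1/(k+1)] and [- f - 1/(k+1)] have negative integral, hence sums bounded above almost
    everywhere. Dividing by [N] bounds the averages of [f] and of [- f] by [1/(k+1)] in the limit,
    for all [k] at once. *)
Lemma birkhoff_avg_cvg0_ae f : bounded_measurable f -> \int[nu]_y f y = 0 ->
  {ae nu, forall y, avg (fun n => f (iter n S y)) @ \oo --> 0}.
Proof.
move=> bf f0.
have sum_ae (c : R) k : {ae nu, forall y, exists K : nat, forall n,
    birkhoff_sum (fun y => c * f y - k.+1%:R^-1) n y <= K%:R}.
  have bcf := bounded_measurableM (bounded_measurable_cst Y c) bf.
  have bk := bounded_measurable_cst Y (- k.+1%:R^-1 : R).
  apply: birkhoff_sum_bounded_ae; first exact: bounded_measurableD.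
  by rewrite expectD// expectZ// f0 mulr0 add0r expect_cst oppr_lt0 invr_gt0.
have avg_le c k y (K N : nat) : (0 < N)%N ->
    birkhoff_sum (fun y => c * f y - k.+1%:R^-1) N y <= K%:R ->
    c * avg (fun n => f (iter n S y)) N <= K%:R / N%:R + k.+1%:R^-1.
  move=> N0 le_K; rewrite -lerBlDr -[k.+1%:R^-1](@avg_cst R _ N)// -avgZ -avgB.
  by rewrite /avg mulrC ler_wpM2r ?invr_ge0.
have := ae_foralln (sum_ae (-1)); have := ae_foralln (sum_ae 1).
apply: filterS2 => y yp yn; apply/cvgrPdist_lt => e e0.
have e20 : 0 < e / 2 by rewrite divr_gt0.
have [k ke] : exists k, k.+1%:R^-1 < e / 2.
  have [k _ /(_ k (leqnn k))] := near_infty_natSinv_lt (PosNum e20).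
  by exists k.
have [[K1 yK1] [K2 yK2]] := (yp k, yn k).
have lim0 : (fun N : nat => (maxn K1 K2)%:R / N%:R : R) @ \oo --> 0 by exact: cvg_divn.
have /cvgrPdist_lt/(_ _ e20)[M _ MP] := lim0; exists M.+1 => // N /= MN.
have N0 : (0 < N)%N by apply: leq_trans MN.
have {MP} := MP N (ltnW MN).
rewrite /= sub0r normrN ger0_norm ?divr_ge0// => KN.
have le1 := avg_le _ _ _ _ _ N0 (yK1 N); have le2 := avg_le _ _ _ _ _ N0 (yK2 N).
have K1N : K1%:R / N%:R <= (maxn K1 K2)%:R / N%:R :> R.
  by rewrite ler_wpM2r ?invr_ge0// ler_nat leq_maxl.
have K2N : K2%:R / N%:R <= (maxn K1 K2)%:R / N%:R :> R.
  by rewrite ler_wpM2r ?invr_ge0// ler_nat leq_maxr.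
move: le1 le2 KN K1N K2N ke; rewrite mul1r mulN1r sub0r normrN ltr_norml.
move: (avg _ N) (K1%:R / _) (K2%:R / _) ((maxn _ _)%:R / _) (k.+1%:R^-1) => a b1 b2 b3 b4 *.
by apply/andP; split; lra.
Qed.

(** Pointwise convergence of the averages, multiplied by [g] and integrated by dominated
    convergence. *)
Lemma mean_ergodic g f : bounded_measurable g -> bounded_measurable f ->
  \int[nu]_y f y = 0 ->
  avg (fun n => \int[nu]_y (g y * f (iter n S y))) @ \oo --> 0.
Proof.
move=> bg bf f0; have [[mg [Cg gC]] [mf [Cf fC]]] := (bg, bf).
have bgf n := bounded_measurableM bg (bounded_measurable_iter n bf).
pose F N y := g y * avg (fun n => f (iter n S y)) N.
have FE N : F N = (fun y => N%:R^-1 * \sum_(0 <= n < N) (g y * f (iter n S y))).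
  by apply/funext => y; rewrite /F /avg -mulr_sumr mulrCA.
have bF N : bounded_measurable (F N).
  rewrite FE; apply: bounded_measurableM; first exact: bounded_measurable_cst.
  exact: bounded_measurable_sum.
have intF N : \int[nu]_y F N y = avg (fun n => \int[nu]_y (g y * f (iter n S y))) N.
  by rewrite FE expectZ ?expect_sum//; exact: bounded_measurable_sum.
have FB N y : `|F N y| <= Cg * Cf.
  rewrite normrM ler_pM// norm_avg_le//.
  by rewrite (le_trans _ (fC y)).
have mF N : measurable_fun [set: Y] (EFin \o F N).
  by apply/measurable_EFinP; have [] := bF N.
have F0 : {ae nu, forall y, [set: Y] y -> (fun N => (EFin \o F N) y) @ \oo --> cst 0%E y}.
  apply: filterS (birkhoff_avg_cvg0_ae bf f0) => y avg0 _.
  apply: cvg_EFin; first exact: nearW.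
  suff : (fun N => F N y) @ \oo --> g y * 0 by rewrite mulr0.
  exact: cvgMr.
have iC : nu.-integrable [set: Y] (cst (Cg * Cf)%:E).
  exact: (bounded_measurable_integrable nu (bounded_measurable_cst Y (Cg * Cf))).
have FC : {ae nu, forall y N, [set: Y] y -> (`|(EFin \o F N) y| <= cst (Cg * Cf)%:E y)%E}.
  by apply: aeW => y N _; rewrite /= lee_fin.
have [_ _] := dominated_convergence measurableT mF (measurable_cst _) F0 iC FC.
rewrite integral0 => /fine_cvg.
by apply: cvg_trans; apply: near_eq_cvg; apply: nearW => N; rewrite -intF.
Qed.

End ergodic_averages.

(** * Weakly mixing systems and generic points *)

Lemma continuous_preimage_borel (X Z : topologicalType) (f : X -> Z) (B : set Z) :
  continuous f -> <<s @open Z >> B -> <<s @open X >> (f @^-1` B).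
Proof.
move=> /continuousP cf; rewrite -[f @^-1` B]setTI; move: B.
apply: smallest_sub.
  apply: (@sigma_algebra_image _ _ _ f <<s @open X >>); exact: smallest_sigma_algebra.
by move=> B oB; rewrite /image_set_system/= setTI; apply: sub_sigma_algebra; exact: cf.
Qed.

Lemma continuous_borel (X Z : ptopologicalType) (f : X -> Z) : continuous f ->
  measurable_fun [set: borel X] (f : borel X -> borel Z).
Proof.
by move=> cf _ B mB; rewrite setTI; exact: continuous_preimage_borel.
Qed.

Lemma continuous_borel_real (R : realType) (X : ptopologicalType) (f : X -> R) :
  continuous f -> measurable_fun [set: borel X] (f : borel X -> R).
Proof.
move=> /continuousP cf; apply: (measurability _ (RGenOpens.measurableE R)).
move=> _ [_ [a [b ->] <-]]; rewrite setTI; apply: sub_sigma_algebra.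
by apply: cf; exact: interval_open.
Qed.

Lemma continuous_bounded_measurable (R : realType) (X : ptopologicalType)
    (f : X -> R) : compact [set: X] -> continuous f ->
  bounded_measurable (f : borel X -> R).
Proof.
move=> cX cf; split; first exact: continuous_borel_real.
have /compact_bounded[C [_ fC]] : compact (f @` [set: X]).
  by apply: continuous_compact => //; exact: continuous_subspaceT.
exists (`|C| + 1) => y; apply: (fC (`|C| + 1)); last by exists y.
by rewrite (le_lt_trans (ler_norm C))// ltrDl.
Qed.

(** * The product system and decay of correlations *)

Section product_system.
Variables (R : realType) (X : ptopologicalType) (T : X -> X).
Variable mu : probability (borel X) R.
Hypothesis sysT : measure_preserving_system T mu.
Hypothesis wmT : weakly_mixing T mu.

Let T2 (z : borel X * borel X) : borel X * borel X := (T z.1, T z.2).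
Let nu : probability (borel X * borel X)%type R := (mu \x mu)%E.

Let mT : measurable_fun [set: borel X] (T : borel X -> borel X).
Proof. by apply: continuous_borel; exact: mps_continuous sysT. Qed.

Lemma measurable_product_map : measurable_fun [set: borel X * borel X] T2.
Proof.
apply: measurable_fun_pair.
  exact: (measurableT_comp mT measurable_fst).
exact: (measurableT_comp mT measurable_snd).
Qed.

(** The image of [nu] under [T2] agrees with [nu] on rectangles, which determine a product
    measure. *)
Lemma product_map_invariant (B : set (borel X * borel X)) :
  measurable B -> nu (T2 @^-1` B) = nu B.
Proof.
move=> mB; apply/esym.
apply: (@product_measure_unique _ _ _ _ R mu mu
  (measure_function_pushforward__canonical__measure_function_Measure
    nu measurable_product_map)) => //.
move=> A C mA mC; rewrite /= /pushforward.
rewrite (_ : _ @^-1` _ = (T @^-1` A) `*` (T @^-1` C)) //.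
rewrite product_measure1E; last 2 first.
  by rewrite -[X in measurable X]setTI; exact: mT.
  by rewrite -[X in measurable X]setTI; exact: mT.
by congr (_ * _)%E; exact: (mps_invariant sysT).
Qed.

(** The projections are continuous, so sets of the product sigma-algebra are Borel in [X * X], where
    [weakly_mixing] applies. *)
Lemma product_map_ergodic (B : set (borel X * borel X)) :
  measurable B -> T2 @^-1` B = B -> nu B = 0%E \/ nu B = 1%E.
Proof.
move=> mB TB; apply: (wmT _ TB); move: B mB {TB}.
apply: smallest_sub; first exact: smallest_sigma_algebra.
move=> _ [[A mA <-]|[A mA <-]]; rewrite setTI.
  exact: (@continuous_preimage_borel (X * X)%type X fst _ (fun=> cvg_fst) mA).
exact: (@continuous_preimage_borel (X * X)%type X snd _ (fun=> cvg_snd) mA).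
Qed.

Lemma expect_product (g : borel X -> R) : bounded_measurable g ->
  \int[nu]_z (g z.1 * g z.2) = (\int[mu]_x g x) ^+ 2.
Proof.
move=> bg; have [mg [C gC]] := bg.
have bgg : bounded_measurable (fun z : borel X * borel X => g z.1 * g z.2).
  split; last by exists (C * C) => z; rewrite normrM ler_pM.
  apply: measurable_funM.
    exact: (measurableT_comp mg measurable_fst).
  exact: (measurableT_comp mg measurable_snd).
have ig := bounded_measurable_integrable mu bg.
have igg := bounded_measurable_integrable nu bgg.
rewrite /Rintegral -(integral12_prod_meas1 igg) /fubini_F/=.
under eq_integral => x _.
  under eq_integral do rewrite EFinM.
  rewrite integralZl//.
  over.
rewrite /=.
have /fineK <- : (\int[mu]_y (g y)%:E)%E \is a fin_num by exact: integrable_fin_num.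
rewrite integralZr// fineM ?expr2// integrable_fin_num//.
Qed.

Let iter_T2 n z : iter n T2 z = (iter n T z.1, iter n T z.2).
Proof. by elim: n => [|n IH] /=; [case: z|rewrite IH]. Qed.

(** With [F = f (x) f], the square of the [n]-th correlation of [f] is the [n]-th correlation of [F]
    under [T2]. These average to [0] by the ergodic theorem, and the square of an average is at most
    the average of the squares. *)
Lemma weakly_mixing_corr (f : borel X -> R) : bounded_measurable f ->
  \int[mu]_x f x = 0 ->
  avg (fun n => `|\int[mu]_x (f x * f (iter n T x))|) @ \oo --> 0.
Proof.
move=> bf f0; have [mf [C fC]] := bf.
pose F (z : borel X * borel X) := f z.1 * f z.2.
have bF : bounded_measurable F.
  split; last by exists (C * C) => z; rewrite normrM ler_pM.
  apply: measurable_funM.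
    exact: (measurableT_comp mf measurable_fst).
  exact: (measurableT_comp mf measurable_snd).
have F0 : \int[nu]_z F z = 0 by rewrite expect_product// f0 expr0n.
have := mean_ergodic measurable_product_map product_map_invariant
  product_map_ergodic bF bF F0.
move=> lim; apply: sqr_cvg0; move: lim; apply: squeeze_cvgr (cvg_cst 0).
apply: nearW => N; rewrite sqr_ge0 (le_trans (sqr_avg_le _ _))//.
rewrite le_eqVlt; apply/orP; left; apply/eqP; apply: eq_avg => n _.
rewrite real_normK ?num_real// -expect_product; last first.
  exact: bounded_measurableM bf (bounded_measurable_iter mT n bf).
by apply: eq_Rintegral => z _; rewrite /F iter_T2 mulrACA.
Qed.

End product_system.

(** * Sequences read along a generic orbit *)

Section generic_points.
Variables (R : realType) (X : ptopologicalType) (T : X -> X).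
Variables (mu : probability (borel X) R) (x : X).
Hypothesis sysT : measure_preserving_system T mu.
Hypothesis wmT : weakly_mixing T mu.
Hypothesis genx : generic T mu x.

Definition orbit_sequences : set (nat -> R) :=
  [set u | exists2 f : X -> R, continuous f & u = (fun n => f (iter n T x))].

Lemma mean_orbit (f : X -> R) : continuous f ->
  mean (fun n => f (iter n T x)) = \int[mu]_y f y.
Proof. by move=> cf; apply: mean_eq; exact: genx. Qed.

Lemma continuous_iter n : continuous (iter n T).
Proof.
elim: n => [|n IH] y; first exact: cvg_id.
by apply: (continuous_comp (IH y)); exact: mps_continuous sysT _.
Qed.

(** Genericity turns means into integrals. In particular the lag [h] correlation of a sequence is
    the integral of [f] times [f o T^h], again a continuous function. *)
Lemma mixing_algebra_orbit : mixing_algebra orbit_sequences.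
Proof.
split.
- by move=> c; exists (fun=> c) => // y; exact: cvg_cst.
- move=> _ _ [f cf ->] [g cg ->]; exists (fun y => f y + g y) => // y.
  by apply: cvgD; [exact: cf|exact: cg].
- move=> _ _ [f cf ->] [g cg ->]; exists (fun y => f y * g y) => // y.
  by apply: cvgM; [exact: cf|exact: cg].
- move=> _ [f cf ->]; exists (f \o T) => // y.
  by apply: continuous_comp; [exact: mps_continuous sysT _|exact: cf].
- move=> _ [f cf ->].
  have [_ [C fC]] := continuous_bounded_measurable (mps_compact sysT) cf.
  by exists C => n.
- by move=> _ [f cf ->]; apply/cvg_ex; exists (\int[mu]_y f y); exact: genx.
- move=> _ [f cf ->]; rewrite mean_orbit// => f0.
  have bf := continuous_bounded_measurable (mps_compact sysT) cf.
  have := weakly_mixing_corr sysT wmT bf f0; apply: cvg_trans.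
  apply: near_eq_cvg; apply: nearW => N; apply: eq_avg => h _; congr (`|_|).
  rewrite -(@mean_orbit (fun y => f y * f (iter h T y))); last first.
    move=> y; apply: cvgM; first exact: cf.
    have /(_ y) ch := @continuous_iter h.
    exact: (@continuous_comp _ _ _ (iter h T) f y ch (cf _)).
  by congr mean; apply/funext => n; rewrite addnC iterD.
Qed.

End generic_points.

Lemma WM_set_mixing_algebra (R : realType) (A : set nat) : WM_set R A ->
  exists S : set (nat -> R), [/\ mixing_algebra S,
    S (fun n => (n \in A)%:R) & mean (fun n => (n \in A)%:R : R) != 0].
Proof.
move=> [Apos [mu [sys wm gen]] [d dA d0]].
set x := subshift_point (indicator A) in gen.
set T := @subshift_map (indicator A) in sys wm gen.
have valT n : val (iter n T x) = iter n left_shift (indicator A).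
  by elim: n => [//|n IH]; rewrite /= IH.
have shiftE n (w : cantor_space) k : iter n left_shift w k = w (n + k)%N.
  by elim: n k => [//|n IH] k; rewrite iterS {1}/left_shift IH addnS addSn.
have mS := mixing_algebra_orbit sys wm gen.
have SA : @orbit_sequences R _ T x (fun n => (n \in A)%:R).
  (* The coordinate at [0], read along the orbit of the indicator, returns the indicator. *)
  exists (fun w : subshift (indicator A) => ((val w : cantor_space) 0%N)%:R).
    move=> w.
    have cval : {for w, continuous (fun w : subshift (indicator A) => (val w : cantor_space))}.
      exact: initial_continuous.
    have cproj : {for val w, continuous (fun w : cantor_space => w 0%N)}.
      exact: (@proj_continuous nat (fun=> bool) 0%N).
    have cnat : {for (val w : cantor_space) 0%N, continuous (fun b : bool => b%:R : R)}.
      move=> U /nbhs_singleton Ub; rewrite nbhs_principalE.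
      by move=> _ /= ->.
    exact: (continuous_comp (continuous_comp cval cproj) cnat).
  by apply/funext => n; rewrite valT shiftE addn0.
exists (@orbit_sequences R _ T x); split => //.
(* The density counts from [1] to [N] and [avg] from [0] to [N - 1], hence the shift by one. *)
rewrite (_ : mean _ = d) ?gt_eqF// -(mean_shift mS 1 SA).
apply: mean_eq; move: dA; apply: cvg_trans; apply: near_eq_cvg; apply: nearW => N.
rewrite /avg big_add1/=; congr (_ * _); apply: eq_bigr => n _.
by rewrite indicE addn1.
Qed.

(** * Rado's columns condition *)

Lemma common_denominator (I : finType) (t : I -> rat) :
  exists2 D : nat, (0 < D)%N & exists z : I -> int, forall j, D%:R * t j = (z j)%:~R.
Proof.
pose D := (\prod_(j : I) `|denq (t j)|)%N.
exists D; first by rewrite prodn_gt0// => j; rewrite absz_gt0 denq_neq0.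
exists (fun j => numq (t j) * (\prod_(k | k != j) `|denq (t k)|)%N%:Z) => j.
have dt : (`|denq (t j)|%N)%:R * t j = (numq (t j))%:~R.
  rewrite -[_%:R]/((_%:Z)%:~R : rat) absz_denq -{2}[t j]divq_num_den mulrC.
  by rewrite divfK// intr_eq0 denq_neq0.
by rewrite /D (bigD1 j)//= natrM intrM -dt mulrAC.
Qed.

(** For [n > 0] and [p] prime, the last nonzero digit of [n] in base [p]. *)
Definition last_digit p n := ((n %/ p ^ logn p n) %% p)%N.

Lemma last_digit_gt0 p n : prime p -> (0 < n)%N -> (0 < last_digit p n)%N.
Proof.
move=> pp n0; rewrite lt0n; apply/negP => /dvdnP.
have [m] := pfactor_coprime pp n0.
rewrite prime_coprime// => pm {1}->; rewrite mulnK ?expn_gt0 ?prime_gt0//.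
by move=> [k mk]; rewrite mk dvdn_mull in pm.
Qed.

Lemma last_digit_small p n : prime p -> (0 < n < p)%N -> last_digit p n = n.
Proof.
move=> pp /andP[n0 np]; rewrite /last_digit lognE pp n0/= gtnNdvd//.
by rewrite divn1 modn_small.
Qed.

Lemma last_digit_partition p : prime p ->
  partition [set: 'I_p.-1]
    (fun i : 'I_p.-1 => [set n | (0 < n)%N /\ last_digit p n = i.+1])
    positive_integers.
Proof.
move=> pp; have pK : p.-1.+1 = p by rewrite prednK ?prime_gt0.
split.
- apply/seteqP; split=> [n [i _ []]//|n /= n0].
  have d0 := last_digit_gt0 pp n0.
  have dp : ((last_digit p n).-1 < p.-1)%N.
    by rewrite -ltnS pK prednK// ltn_mod prime_gt0.
  by exists (Ordinal dp) => //; split => //=; rewrite prednK.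
- move=> i j _ _ [n [[_ di] [_ dj]]]; apply/val_inj.
  by move: dj; rewrite di => -[].
(* The classes of a [partition] must be nonempty; [i + 1 < p] is its own last digit. *)
- move=> i _; exists i.+1; split => //; apply: last_digit_small => //=.
  by rewrite -[X in (_ < X)%N]pK ltnS.
Qed.

Section columns_condition.
Variables (m q : nat) (a : 'M[rat]_(m, q)).

(** The requirement of Rado's columns condition on a block [I] with earlier blocks [J]. *)
Definition spanned (J I : {set 'I_q}) := exists lam : 'I_q -> rat,
  forall i, \sum_(j in I) a i j = \sum_(j in J) lam j * a i j.

(** A vector outside a row space is detected by some column of the cokernel matrix. *)
Lemma not_spanned_functional (J I : {set 'I_q}) : ~ spanned J I ->
  exists u : 'I_m -> rat, (forall j, j \in J -> \sum_i u i * a i j = 0) /\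
    \sum_(j in I) \sum_i u i * a i j != 0.
Proof.
move=> nspan.
pose B : 'M[rat]_(q, m) := \matrix_(j, i) (if j \in J then a i j else 0).
pose v : 'rV[rat]_m := \row_i \sum_(j in I) a i j.
have : ~~ (v <= B)%MS.
  apply/negP => /submxP[D vDB]; apply: nspan; exists (D 0) => i.
  have /matrixP/(_ 0 i) := vDB; rewrite !mxE => ->.
  rewrite [RHS]big_mkcond; apply: eq_bigr => j _; rewrite mxE.
  by case: ifP => _ //; rewrite mulr0.
rewrite submxE => /eqP/matrixP/existsNP[k0 /existsNP[k]].
rewrite ord1 => /eqP; rewrite !mxE => vk.
exists (fun i => cokermx B i k); split.
  move=> j jJ; have /matrixP/(_ j k) := mulmx_coker B.
  rewrite !mxE => Bk; rewrite -[RHS]Bk; apply: eq_bigr => i _.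
  by rewrite [B j i]mxE jJ mulrC.
rewrite exchange_big/=; apply: contraNN vk => /eqP vk; apply/eqP.
rewrite -[RHS]vk; apply: eq_bigr => i _.
by rewrite [v 0 i]mxE mulr_suml; apply: eq_bigr => j _; rewrite mulrC.
Qed.

(** Otherwise a functional gives integers [z j], zero on [J], with nonzero sum over [I] and
    [\sum_j z j * x j = 0]. Divided by [p ^ v] and reduced modulo [p], only the terms of [I]
    survive, each with digit [d]. So [p] divides [d] times the sum of [z] over [I], which is
    impossible for large [p]. *)
Lemma spanned_of_large_prime (J I : {set 'I_q}) : exists N, forall p d v (x : 'I_q -> nat),
  prime p -> (N < p)%N -> (forall j, (0 < x j)%N /\ last_digit p (x j) = d) ->
  solution a x -> J = [set j | (logn p (x j) < v)%N]%SET ->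
  I = [set j | logn p (x j) == v]%SET -> spanned J I.
Proof.
have [span|/not_spanned_functional[u [uJ uI]]] := pselect (spanned J I).
  by exists 0%N.
pose t j := \sum_i u i * a i j.
have [D D0 [z tz]] := common_denominator t.
exists (absz (\sum_(j in I) z j)) => p d v x pp Np xd sol JE IE; exfalso.
have zJ j : j \in J -> z j = 0.
  by move=> /uJ tj; apply/eqP; rewrite -(intr_eq0 rat) -tz /t tj mulr0.
have zI : \sum_(j in I) z j != 0.
  rewrite -(intr_eq0 rat) rmorph_sum/=.
  under eq_bigr do rewrite -tz.
  by rewrite -mulr_sumr mulf_neq0// pnatr_eq0 -lt0n.
have zx : \sum_j z j * (x j)%:Z = 0.
  apply/eqP; rewrite -(intr_eq0 rat) rmorph_sum/=; apply/eqP.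
  under eq_bigr do rewrite intrM -tz -mulrA.
  rewrite -mulr_sumr (_ : \sum_j _ = 0) ?mulr0//.
  under eq_bigr do rewrite mulr_suml.
  rewrite exchange_big/= big1// => i _.
  under eq_bigr do rewrite -mulrA.
  by rewrite -mulr_sumr sol mulr0.
(* The division is exact outside [J]; on [J] the rounding is harmless because [z j = 0]. *)
pose y j := (x j %/ p ^ v)%N.
have pv0 : (p ^ v)%N%:Z != 0 by rewrite eqz_nat -lt0n expn_gt0 prime_gt0.
have zy : \sum_j z j * (y j)%:Z = 0.
  apply: (mulIf pv0); rewrite mul0r -[RHS]zx mulr_suml; apply: eq_bigr => j _.
  have [jJ|jJ] := boolP (j \in J); first by rewrite zJ// !mul0r.
  rewrite -mulrA -PoszM divnK//; apply: dvdn_trans (pfactor_dvdnn p (x j)).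
  by rewrite dvdn_exp2l// leqNgt; move: jJ; rewrite JE inE.
have pd : (p %| \sum_j z j * ((y j)%:Z - (if j \in I then d%:Z else 0)))%Z.
  apply: rpred_sum => j _.
  have [jJ|jJ] := boolP (j \in J); first by rewrite zJ// mul0r dvdz0.
  have [x0 xj] := xd j.
  apply: dvdz_mull; rewrite IE inE; case: eqP => jv.
    rewrite -xj /last_digit jv -/(y j) -eqz_mod_dvd; apply/eqP.
    by rewrite modz_nat modz_nat modn_mod.
  rewrite subr0 dvdzE/= /y -(dvdn_pmul2r (_ : (0 < p ^ v)%N)) ?expn_gt0 ?prime_gt0//.
  have vlt : (v < logn p (x j))%N.
    rewrite ltn_neqAle eq_sym (introN eqP jv) leqNgt.
    by move: jJ; rewrite JE inE.
  rewrite divnK -?expnS; first by rewrite pfactor_dvdn.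
  by rewrite pfactor_dvdn// ltnW.
move: pd; under eq_bigr do rewrite mulrBr.
rewrite sumrB zy sub0r rpredN.
rewrite (_ : \sum_j _ = (\sum_(j in I) z j) * d%:Z); last first.
  rewrite mulr_suml [RHS]big_mkcond; apply: eq_bigr => j _.
  by case: ifP => _ //; rewrite mulr0.
rewrite dvdzE abszM Euclid_dvdM//= => /orP[|].
  by rewrite gtnNdvd// absz_gt0.
have [j jI] : exists j, j \in I.
  case: (pickP (mem I)) => [j jI|I0]; first by exists j.
  by move: zI; rewrite big_pred0 ?eqxx.
have [x0 <-] := xd j; rewrite gtnNdvd ?last_digit_gt0// ltn_mod prime_gt0//.
Qed.

(* The colour class of a large prime [p] is the last nonzero digit in base [p]:
   a monochromatic solution, ordered by p-adic valuation, exhibits the blocks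
   of Rado's columns condition. *)
Lemma partition_regular_columns : partition_regular a ->
  exists w : 'I_q -> nat, forall v,
    spanned [set j | (w j < v)%N]%SET [set j | w j == v]%SET.
Proof.
move=> pr.
have /choice[N NP] := fun JI : {set 'I_q} * {set 'I_q} => spanned_of_large_prime JI.1 JI.2.
(* The blocks are known only after the colouring, so [p] must exceed the thresholds of all pairs of
   sets. *)
have [p Np pp] := prime_above (\max_JI N JI).
have [d [x [xd sol]]] := pr _ _ (last_digit_partition pp).
exists (fun j => logn p (x j)) => v.
pose JI := ([set j | (logn p (x j) < v)%N]%SET, [set j | logn p (x j) == v]%SET).
apply: (NP JI p d.+1 v x) => //.
by apply: leq_ltn_trans Np; exact: leq_bigmax.
Qed.

(** The relation for block [v] gives a solution [z0] that may be negative on earlier blocks. The sum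
    [s] of the earlier solutions is at least [1] there and [0] from block [v] on, so adding a large
    multiple of it repairs the signs. *)
Lemma nonneg_block_solution (w : 'I_q -> nat) :
  (forall v, spanned [set j | (w j < v)%N]%SET [set j | w j == v]%SET) ->
  forall v, exists z : 'I_q -> rat, [/\ forall j, 0 <= z j,
    forall j, w j = v -> z j = 1, forall j, (v < w j)%N -> z j = 0 &
    forall i, \sum_j a i j * z j = 0].
Proof.
move=> wspan v; elim/ltn_ind: v => v IH.
have [lam lamP] := wspan v.
have /choice[zk zkP] : forall k, exists z : 'I_q -> rat, (k < v)%N -> [/\ forall j, 0 <= z j,
    forall j, w j = k -> z j = 1, forall j, (k < w j)%N -> z j = 0 &
    forall i, \sum_j a i j * z j = 0].
  move=> k; have [kv|kv] := boolP (k < v)%N; last by exists (fun=> 0).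
  by have [z zP] := IH k kv; exists z.
pose z0 j := if w j == v then 1 else if (w j < v)%N then - lam j else 0.
pose K := \sum_j `|lam j|.
pose s j := \sum_(0 <= k < v) zk k j.
have s_ge0 j : 0 <= s j.
  rewrite /s big_nat; apply: sumr_ge0 => k /andP[_ kv].
  by have [] := zkP k kv.
have s0 j : (v <= w j)%N -> s j = 0.
  move=> vj; rewrite /s big_nat big1// => k /andP[_ kv].
  by have [_ _ -> //] := zkP k kv; exact: leq_trans vj.
have s1 j : (w j < v)%N -> 1 <= s j.
  move=> jv; have [z_ge0 z1 _ _] := zkP _ jv.
  rewrite /s (bigD1_seq (w j)) ?iota_uniq ?mem_index_iota//= z1// lerDl.
  rewrite big_seq_cond; apply: sumr_ge0 => k; rewrite mem_index_iota => /andP[/andP[_ kv] _].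
  by have [] := zkP k kv.
have K_ge0 : 0 <= K by rewrite sumr_ge0.
exists (fun j => z0 j + K * s j); split.
- move=> j; rewrite /z0; case: (ltngtP (w j) v) => [jv|jv|jv].
  + rewrite addrC subr_ge0 (@le_trans _ _ K)//; last by rewrite ler_peMr// s1.
    by rewrite (le_trans (ler_norm _))// /K (bigD1 j)//= lerDl sumr_ge0.
  + by rewrite add0r mulr_ge0.
  + by rewrite addr_ge0 ?mulr_ge0.
- by move=> j jv; rewrite /z0 jv eqxx s0 ?jv// mulr0 addr0.
- by move=> j jv; rewrite /z0 gtn_eqF// ltnNge ltnW//= s0 ?mulr0 ?addr0// ltnW.
move=> i; under eq_bigr do rewrite mulrDr.
rewrite big_split/=.
have -> : \sum_j a i j * z0 j = 0.
  transitivity (\sum_(j in [set j | w j == v]%SET) a i j -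
      \sum_(j in [set j | (w j < v)%N]%SET) lam j * a i j).
    rewrite [in RHS]big_mkcond [X in _ - X]big_mkcond -sumrB.
    apply: eq_bigr => j _; rewrite !inE /z0; case: (ltngtP (w j) v) => _.
    - by rewrite sub0r mulrN mulrC.
    - by rewrite mulr0 subr0.
    - by rewrite mulr1 subr0.
  by rewrite lamP subrr.
rewrite add0r; under eq_bigr do rewrite mulrCA mulr_sumr.
rewrite -mulr_sumr exchange_big/= big_nat big1 ?mulr0// => k /andP[_ kv].
by have [] := zkP k kv.
Qed.

Lemma partition_regular_blocks : partition_regular a ->
  exists (c W : nat) (w : 'I_q -> nat) (Z : nat -> 'I_q -> nat), [/\ (0 < c)%N,
    forall j, (w j < W)%N &
    forall v, (v < W)%N -> [/\ solution a (Z v),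
      forall j, w j = v -> Z v j = c & forall j, (v < w j)%N -> Z v j = 0%N]].
Proof.
move=> /partition_regular_columns[w /nonneg_block_solution/choice[z zP]].
pose W := (\max_j w j).+1.
have [c c0 [t tz]] := common_denominator (fun vj : 'I_W * 'I_q => z vj.1 vj.2).
(* The numerators [t] are nonnegative for [v < W], so the absolute value only changes their type. *)
pose Z v j := `|t (inord v, j)|%N.
have ZE v j : (v < W)%N -> (Z v j)%:R = c%:R * z v j.
  move=> vW; have := tz (inord v, j); rewrite /= inordK// => tzj.
  rewrite tzj -[LHS]/((_%:Z)%:~R : rat) gez0_abs// -(ler0z rat) -tzj.
  by rewrite mulr_ge0//; have [] := zP v.
move: Z ZE {tz} => Z ZE.
exists c, W, w, Z; split => //; first by move=> j; rewrite ltnS leq_bigmax.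
move=> v vW; have [z_ge0 z1 z0 zsol] := zP v; split.
- move=> i; under eq_bigr do rewrite ZE// mulrCA.
  by rewrite -mulr_sumr zsol mulr0.
- by move=> j jv; apply/eqP; rewrite -(eqr_nat rat) ZE// z1// mulr1.
- by move=> j jv; apply/eqP; rewrite -(eqr_nat rat) ZE// z0// mulr0.
Qed.

End columns_condition.

(** * Solutions inside a WM set *)

Theorem proposition4p1 (R : realType) (p q : nat) (a : 'M[rat]_(p, q))
  (ha : partition_regular a) (A : set nat) (hA : WM_set R A) :
  exists x : 'I_q -> nat, (forall j, A (x j)) /\ solution a x.
Proof.
have [c [W [w [Z [c0 wW ZP]]]]] := partition_regular_blocks ha.
have [S [mS SA A0]] := WM_set_mixing_algebra hA.
pose P := (\max_(v < W) \max_j Z v j)%N.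
have ZP_le v j : (v < W)%N -> (Z v j <= P)%N.
  move=> vW; apply: leq_trans (leq_bigmax (Ordinal vW)).
  exact: (@leq_bigmax _ (Z v)).
have [y yP] := exists_configuration mS P W SA A0 c0.
(* Blocks are taken in reverse order. For [j] in block [w j], the term [i0 = W - 1 - w j] has
   coefficient [c], later terms come from blocks before [w j] and vanish, and earlier ones have
   coefficients at most [P]. *)
pose x j := (\sum_(0 <= i < W) Z (W.-1 - i) j * y i)%N.
exists x; split=> [j|i].
  have wjW := wW j; pose i0 := (W.-1 - w j)%N.
  have i0W : (i0 < W)%N by rewrite /i0; lia.
  have x_eq : x j = (c * y i0 + \sum_(0 <= i < i0) Z (W.-1 - i) j * y i)%N.
    rewrite /x (big_cat_nat _ (n := i0.+1))//= [X in (_ + X)%N]big_nat.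
    rewrite [X in (_ + X)%N]big1 => [|i /andP[ii iW]]; last first.
      have vW : (W.-1 - i < W)%N by lia.
      by have [_ _ ->] := ZP _ vW; rewrite /i0 in ii; lia.
    rewrite addn0 big_nat_recr//= addnC; congr (_ * _ + _)%N.
    have vW : (W.-1 - i0 < W)%N by lia.
    by have [_ -> //] := ZP _ vW; rewrite /i0; lia.
  (* The cap by [P] makes the bound hold for every index; it changes nothing on the range of the
     sum. *)
  have := yP i0 i0W (fun i => minn P (Z (W.-1 - i)%N j)) (fun i => geq_minl _ _).
  rewrite (_ : (_ + _)%N = x j); first by rewrite pnatr_eq0 eqb0 negbK => /set_mem.
  rewrite x_eq; congr (_ + _)%N; apply: eq_big_nat => i /andP[_ ii].
  by congr (_ * _)%N; apply/minn_idPr/ZP_le; lia.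
(* The system is linear and homogeneous, so a combination of the solutions [Z v] is a solution. *)
rewrite /x; under eq_bigr do rewrite natr_sum mulr_sumr.
rewrite exchange_big/= big_nat big1// => k /andP[_ kW].
under eq_bigr do rewrite natrM mulrA.
have vW : (W.-1 - k < W)%N by lia.
by have [sol _ _] := ZP _ vW; rewrite -mulr_suml sol mul0r.
Qed.
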